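(* (a) For any even $k\geq 6$, the group $\Gamma$ generated by reflections in the sides of a convex right-angled $k$-gon of $\mathbb{H}^2$ admits properly discontinuous affine actions on $\mathfrak{g}=\mathfrak{o}(3,1)\simeq\mathbb{R}^6$. (b) The group $\Gamma$ generated by reflections in the faces of a $4$-dimensional regular right-angled $120$-cell admits properly discontinuous affine actions on $\mathfrak{g}=\mathfrak{o}(8,1)\simeq\mathbb{R}^{36}$.
   Context: In (a) the $k$-gon is a compact convex polygon of the hyperbolic plane with $k$ sides and all angles equal to $\pi/2$; in (b) the $120$-cell is the compact regular $120$-cell of the hyperbolic space $\mathbb{H}^4$ all of whose dihedral angles are $\pi/2$, and its faces are its $120$ dodecahedral (codimension-one) facets. The affine actions of $\Gamma$ on $\mathfrak{g}=\mathfrak{o}(n,1)$ considered here are those determined by a representation $(\rho,u):\Gamma\to G\ltimes\mathfrak{g}$ with $G=\mathrm{O}(n,1)$, where $\rho:\Gamma\to G$ is a homomorphism and $u:\Gamma\to\mathfrak{g}$ is a $\rho$-cocycle, i.e. $u(\gamma_1\gamma_2)=u(\gamma_1)+\mathrm{Ad}(\rho(\gamma_1))u(\gamma_2)$; the action is $\gamma\bullet v=\mathrm{Ad}(\rho(\gamma))v+u(\gamma)$. It is properly discontinuous if for every compact $\mathscr{C}\subset\mathfrak{g}$ only finitely many $\gamma$ satisfy $\gamma\bullet\mathscr{C}\cap\mathscr{C}\neq\varnothing$. *)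

(* Defs.v *)
From HB Require Import structures.
From mathcomp Require Import all_boot all_order all_algebra all_fingroup.
From mathcomp Require Import all_classical all_reals all_analysis.

Set Implicit Arguments.
Unset Strict Implicit.
Unset Printing Implicit Defensive.

Import Order.TTheory GRing.Theory Num.Theory.
Import numFieldNormedType.Exports.

Local Open Scope classical_set_scope.
Local Open Scope ring_scope.

Section Lorentz.
Context {R : realType} {n : nat}.
Implicit Types (x y v w : 'cV[R]_(n + 1)) (A g : 'M[R]_(n + 1)).

(* The last coordinate is the timelike one. *)
Definition lorentz_mx : 'M[R]_(n + 1) := block_mx 1%:M 0 0 (- 1%:M).

Definition lorentz x y : R := (x^T *m lorentz_mx *m y) 0 0.

Definition hyperboloid : set 'cV[R]_(n + 1) :=
  [set x | lorentz x x = -1 /\ 0 < dsubmx x 0 0].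

Definition indef_orth : set 'M[R]_(n + 1) :=
  [set A | A^T *m lorentz_mx *m A = lorentz_mx].

Definition indef_orth_lie : set 'M[R]_(n + 1) :=
  [set A | A^T *m lorentz_mx + lorentz_mx *m A = 0].

Definition hyp_isometry : set 'M[R]_(n + 1) :=
  [set g | indef_orth g /\ forall x, hyperboloid x -> hyperboloid (g *m x)].

(* The matrix of x |-> x - 2 (<v, x> / <v, v>) v; for <v, v> > 0 it restricts
   to the reflection of the hyperbolic space in the hyperplane orthogonal
   to v. *)
Definition reflection_mx v : 'M[R]_(n + 1) :=
  1%:M - (2 / lorentz v v) *: (v *m v^T *m lorentz_mx).

Inductive generated (S : set 'M[R]_(n + 1)) : 'M[R]_(n + 1) -> Prop :=
| generated_base A : S A -> generated S A
| generated_one : generated S 1%:M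
| generated_mul A g : generated S A -> generated S g -> generated S (A *m g)
| generated_inv A : generated S A -> generated S (invmx A).

Definition reflection_group (N : set 'cV[R]_(n + 1)) : set 'M[R]_(n + 1) :=
  generated [set reflection_mx v | v in N].

(* [N] is a set of outward normals, not necessarily of norm 1, one for each
   bounding hyperplane. *)
Definition polytope (N : set 'cV[R]_(n + 1)) : set 'cV[R]_(n + 1) :=
  [set x | hyperboloid x /\ forall v, N v -> lorentz v x <= 0].

(* The facets orthogonal to v and w share a codimension-two face: some point
   of the polytope lies on these two facets and on no other one. *)
Definition adjacent_facets (N : set 'cV[R]_(n + 1)) v w : Prop :=
  exists x, [/\ polytope N x, lorentz v x = 0, lorentz w x = 0
    & forall z, N z -> z <> v -> z <> w -> lorentz z x < 0].

(* The sign comes from v and w being outward normals. *)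
Definition dihedral_angle v w : R :=
  acos (- (lorentz v w / (Num.sqrt (lorentz v v) * Num.sqrt (lorentz w w)))).

Definition right_angled_polytope (N : set 'cV[R]_(n + 1)) : Prop :=
  forall v w, N v -> N w -> v <> w -> adjacent_facets N v w ->
    dihedral_angle v w = pi / 2.

(* Initial velocity at x, up to a positive factor, of the geodesic from x
   to y. *)
Definition direction x y : 'cV[R]_(n + 1) := y + lorentz x y *: x.

(* The hyperbolic angle at x between the geodesic rays towards y and z. *)
Definition vertex_angle x y z : R :=
  let a := direction x y in let b := direction x z in
  acos (lorentz a b / (Num.sqrt (lorentz a a) * Num.sqrt (lorentz b b))).

End Lorentz.

Arguments indef_orth {R} n.
Arguments indef_orth_lie {R} n.

Section Polygon.
Context {R : realType} {k : nat}.
Variable p : 'I_k -> 'cV[R]_(2 + 1).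

Definition side_normal (i : 'I_k) (v : 'cV[R]_(2 + 1)) : Prop :=
  [/\ 0 < lorentz v v, lorentz v (p i) = 0 & lorentz v (p (ordS i)) = 0].

Definition side_normals : set 'cV[R]_(2 + 1) :=
  [set v | exists i, side_normal i v].

(* [p] lists the vertices in cyclic order; the polygon is their convex hull,
   hence compact.  Convexity: the line through each side has all the other
   vertices strictly on one side. *)
Definition convex_polygon : Prop :=
  [/\ forall i, hyperboloid (p i), injective p
    & forall i, exists2 v, side_normal i v
        & forall j, j != i -> j != ordS i -> lorentz v (p j) < 0].

Definition right_angled_polygon : Prop :=
  convex_polygon /\
  forall i, vertex_angle (p i) (p (ord_pred i)) (p (ordS i)) = pi / 2.

End Polygon.

Section Cell120.
Context {R : realType}.

Definition golden : R := (1 + Num.sqrt 5) / 2.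

(* The vertices of the regular 600-cell inscribed in the unit sphere, i.e.
   the directions of the facets of the dual 120-cell: 8 permutations of
   (+-1, 0, 0, 0), the 16 vectors (+-1/2, +-1/2, +-1/2, +-1/2) and 96 even
   permutations of (+-golden, +-1, +-golden^-1, 0) / 2. *)
Definition vertices_600cell : set 'cV[R]_4 :=
  [set q | [\/ exists i, `|q i 0| = 1 /\ forall j, j != i -> q j 0 = 0,
               forall i, `|q i 0| = 2^-1
             | exists s : 'S_4, [/\ ~~ odd_perm s,
                 `|q (s (inord 0)) 0| = golden / 2,
                 `|q (s (inord 1)) 0| = 2^-1,
                 `|q (s (inord 2)) 0| = golden^-1 / 2
               & q (s (inord 3)) 0 = 0]]].

(* In the projective ball model y = x' / x_4, where x' collects the first four
   coordinates of x, the polytope whose normals are the (q, r) is the Euclidean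
   regular 120-cell of inradius r centred at the origin, given by the
   inequalities q . y <= r. *)
Definition regular_120cell (N : set 'cV[R]_(4 + 1)) : Prop :=
  exists g : 'M[R]_(4 + 1), exists r : R,
    [/\ hyp_isometry g, 0 < r < 1
      & N = [set g *m col_mx q r%:M | q in vertices_600cell]].

Definition compact_right_angled_120cell (N : set 'cV[R]_(4 + 1)) : Prop :=
  [/\ regular_120cell N, compact (polytope N) & right_angled_polytope N].

End Cell120.

Section AffineActions.
Context {R : realType} {m n : nat}.
Variable Gamma : set 'M[R]_(m + 1).
Implicit Types (rho u : 'M[R]_(m + 1) -> 'M[R]_(n + 1)).

Definition Ad (g X : 'M[R]_(n + 1)) : 'M[R]_(n + 1) := g *m X *m invmx g.

Definition representation rho : Prop :=
  (forall g, Gamma g -> indef_orth n (rho g)) /\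
  (forall g h, Gamma g -> Gamma h -> rho (g *m h) = rho g *m rho h).

Definition cocycle rho u : Prop :=
  (forall g, Gamma g -> indef_orth_lie n (u g)) /\
  (forall g h, Gamma g -> Gamma h -> u (g *m h) = u g + Ad (rho g) (u h)).

Definition affine_action rho u (g : 'M[R]_(m + 1)) (X : 'M[R]_(n + 1)) :=
  Ad (rho g) X + u g.

Definition properly_discontinuous rho u : Prop :=
  forall C : set 'M[R]_(n + 1), compact C -> C `<=` indef_orth_lie n ->
    finite_set [set g | Gamma g /\ affine_action rho u g @` C `&` C !=set0].

End AffineActions.

Definition admits_proper_affine_action {R : realType} (m n : nat)
    (Gamma : set 'M[R]_(m + 1)) : Prop :=
  exists rho u : 'M[R]_(m + 1) -> 'M[R]_(n + 1),
    [/\ representation Gamma rho, cocycle Gamma rho u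
      & properly_discontinuous Gamma rho u].
Arguments admits_proper_affine_action {R m} n Gamma.

(* Main.v *)
Require Import Defs.
From HB Require Import structures.
From mathcomp Require Import all_boot all_order all_algebra all_fingroup.
From mathcomp Require Import all_classical all_reals all_analysis.
From mathcomp Require Import ring lra zify.

(** Both groups are right-angled Coxeter groups, generated by the reflections in the
    facets of a polytope, and the cocycle is the derivative of a family of
    representations by reflections in a larger Lorentz group.

    Properness.  Let a representation send a group element to [g], and let [g'] be
    the derivative of [g] along a deformation of the representation.  Then
    [g' g^-1] is a cocycle, and the affine action takes [X] to [X'] if and only if
    [X' g = g X + g'].  For [X] and [X'] in a compact set this bounds [g'] by a
    multiple of the norm of [g].  Hence the action is properly discontinuous as
    soon as the ratio of [g'] to [g] tends to infinity in the group
    (affine_length_bound, proper_affine_action_of_deformation).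

    Growth.  Let [x0] be a base point and [y_k = - <g x0, al_k>] its heights with
    respect to the unit normals [al_k] of the walls.  One more letter [i] replaces
    [y_k] by [y_k + a_ik y_i], where [a_ik = - 2 <al_i, al_k>] vanishes for
    orthogonal walls and is at least 2 for walls that do not meet.  Along reduced
    words the signs of the heights are those of the descents, and suitable
    differences stay positive (sign_pattern_step); so the first letter of a nonempty
    reduced word has a negative height, and geometric representations are faithful
    (word_mx_kernel).  If all the nonzero [a_ik] with distinct [i] and [k] increase
    at a relative speed bounded below, then the derivative of the heights exceeds
    any given multiple of the heights up to a term of small exponential growth
    (dheight_growth), while the heights themselves grow exponentially
    (height_exp_growth).

    The deformation.  Colour the facets so that adjacent facets have different
    colours: two colours for the sides of a polygon with an even number of sides, and
    five for the 120-cell, the cosets of the binary tetrahedral group in the binary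
    icosahedral group.  Put the colours at the vertices of a regular simplex, of
    dimension one less than their number, and give to the normals an additional
    component proportional to their colour.  The time component can be adjusted to
    keep adjacent walls orthogonal, and when the additional component shrinks all the
    other pairs of walls move apart (coloured_expanding).  This happens in dimension
    2 + 1 = 3 for polygons and 4 + 4 = 8 for the 120-cell.

    The given polytopes.  To transport the construction it remains to know that the
    non-adjacent walls of the given polytope do not meet.  For an arbitrary
    right-angled polygon this follows from convexity, in frames adapted to the
    vertices and to the sides (far_normals).  The inradius of the 120-cell is
    determined by compactness and the right angles (right_angled_120cell_radius),
    and its inner products are computed over the golden integers
    (cell600_table). *)

Import Order.TTheory GRing.Theory Num.Theory.
Import numFieldNormedType.Exports.

Set Implicit Arguments.
Unset Strict Implicit.
Unset Printing Implicit Defensive.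

Local Open Scope classical_set_scope.
Local Open Scope ring_scope.

(** * Words in a right-angled Coxeter group *)

Section Words.
Context {S : finType} (com : rel S).
Hypothesis com_sym : symmetric com.
Implicit Types (w : seq S) (i j k : S).

(** Letters of [w] that commute with every letter on their left: when [w] is
    reduced, these are the left descents of the group element. *)
Fixpoint descents w : {set S} :=
  if w is i :: w' then i |: [set j in descents w' | com i j] else finset.set0.

Fixpoint reduced w : bool :=
  if w is i :: w' then (i \notin descents w') && reduced w' else true.

Lemma descents_com w i j :
  i \in descents w -> j \in descents w -> i != j -> com i j.
Proof.
elim: w => [|l w IH] /=; first by rewrite inE.
rewrite !inE => /orP[/eqP->|/andP[iw li]] /orP[/eqP->|/andP[jw lj]] //.
- by rewrite eqxx.
- by rewrite com_sym.
- exact: IH.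
Qed.

Section Eval.
Context {R : realType} {N : nat}.
Implicit Type f : S -> 'M[R]_N.

Definition word_mx f w : 'M[R]_N := foldr (fun i g => f i *m g) 1%:M w.

(** [f] satisfies the defining relations of the right-angled Coxeter group. *)
Definition coxeter_rep f : Prop :=
  (forall i, f i *m f i = 1%:M) /\
  (forall i j, com i j -> f i *m f j = f j *m f i).

Lemma word_mx_cat f w1 w2 : word_mx f (w1 ++ w2) = word_mx f w1 *m word_mx f w2.
Proof. by elim: w1 => [|i w IH] /=; rewrite ?mul1mx // IH mulmxA. Qed.

Lemma word_mx_rev f w : coxeter_rep f -> word_mx f (rev w) *m word_mx f w = 1%:M.
Proof.
move=> [f2 _]; elim: w => [|i w IH] /=; first by rewrite mul1mx.
rewrite rev_cons -cats1 word_mx_cat /= mulmx1 -mulmxA (mulmxA (f i)) f2 mul1mx.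
exact: IH.
Qed.

Lemma word_mx_unit f w : coxeter_rep f -> word_mx f w \in unitmx.
Proof. by move/(word_mx_rev w) => /mulmx1_unit[]. Qed.

Lemma word_mx_inv f w : coxeter_rep f -> invmx (word_mx f w) = word_mx f (rev w).
Proof.
move=> cf; have := word_mx_rev w cf => /(congr1 (mulmx^~ (invmx (word_mx f w)))).
by rewrite mulmxK ?word_mx_unit // mul1mx => ->.
Qed.

End Eval.

(** A descent can be moved to the front of the word by commutations alone, so
    that one more copy of it cancels in every representation at once. *)
Lemma cancel_descent w i : i \in descents w ->
  exists2 w', size w = (size w').+1
    & forall (R : realType) N (f : S -> 'M[R]_N), coxeter_rep f ->
        word_mx f w = f i *m word_mx f w'.
Proof.
elim: w => [|j w IH] /=; first by rewrite inE.
rewrite !inE => /orP[/eqP->|/andP[/IH[w' sw ew'] ji]]; first by exists w.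
exists (j :: w') => [|R N f cf] /=; first by rewrite sw.
by rewrite (ew' R N f cf) !mulmxA cf.2.
Qed.

(** Reduced words reach every group element.  The reduced form is the same for
    all representations, which lets a relation proved in one representation be
    transferred to another. *)
Lemma reduced_word w :
  exists2 w', reduced w'
    & forall (R : realType) N (f : S -> 'M[R]_N), coxeter_rep f ->
        word_mx f w = word_mx f w'.
Proof.
suff H n : forall w, (size w <= n)%N -> exists w', [/\ reduced w', (size w' <= size w)%N
    & forall (R : realType) N (f : S -> 'M[R]_N), coxeter_rep f ->
        word_mx f w = word_mx f w'].
  by have [w' [rw _ ew]] := H _ _ (leqnn (size w)); exists w'.
elim: n => [|n IH] {}w; first by rewrite leqn0 size_eq0 => /eqP->; exists [::].
case: w => [|i w] /=; first by exists [::].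
rewrite ltnS => sw; have [w1 [rw1 sw1 ew1]] := IH _ sw.
have [iw1|iw1] := boolP (i \in descents w1); last first.
  by exists (i :: w1); split=> [||R N f cf] /=; rewrite ?iw1 ?ltnS //= ew1.
have [w2 s2 e2] := cancel_descent iw1.
have s21 : (size w2 < size w)%N by rewrite -s2.
have [w3 [rw3 sw3 ew3]] := IH w2 (leq_trans (ltnW s21) sw).
exists w3; split=> //; first exact: leq_trans sw3 (leq_trans (ltnW s21) (leqnSn _)).
by move=> R N f cf; rewrite -ew3 // ew1 // e2 // mulmxA cf.1 mul1mx.
Qed.

End Words.

(** * Growth along reduced words *)

Section Growth.
Context {R : realType} {S : finType} (com : rel S).
Hypothesis com_sym : symmetric com.
Hypothesis com_irr : irreflexive com.
Variables (a a' : S -> S -> R) (y0 y0' : S -> R) (eta K : R).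
Implicit Types (w : seq S) (i j k : S) (P Q : R -> R -> Prop).

(** For a reflection representation with base point [x0] and roots [r_k], the
    [k]-th height of [w] is [- <w x0, r_k>], with [a i k = - 2 <r_i, r_k>];
    if the heights of the empty word are positive, then the negative ones are those
    of the walls that separate [w x0] from [x0]. *)
Fixpoint height w k : R :=
  if w is i :: w' then height w' k + a i k * height w' i else y0 k.

(** The derivative of the heights when the coefficients [a] and the initial
    values [y0] move with velocities [a'] and [y0']. *)
Fixpoint dheight w k : R :=
  if w is i :: w' then
    dheight w' k + a i k * dheight w' i + a' i k * height w' i
  else y0' k.

(** Walls either cross at right angles or do not meet, and in the second case
    the logarithmic derivative of the Gram entry is at least [eta]. *)
Definition expanding_gram : Prop :=
  [/\ forall i, a i i = -2 /\ a' i i = 0,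
      forall i j, com i j -> a i j = 0 /\ a' i j = 0,
      forall i j, i != j -> ~~ com i j -> 2 <= a i j
    & forall i j, i != j -> a i j <= K /\ eta * a i j <= a' i j].

Hypothesis H : expanding_gram.
Hypothesis eta_ge0 : 0 <= eta.
Hypothesis K_ge0 : 0 <= K.

(** The property [P] of a value and its derivative is required for the heights
    made positive, and also for the gap between the height of a wall and the depth
    below a descent wall that does not commute with it.  These gaps are
    what makes the recursion positive: the new height of a wall that stops being
    a descent, [a i k * y_i - |y_k|], is [(y_i - |y_k|) + (a i k - 1) * y_i]. *)
Definition sign_pattern P w : Prop :=
  [/\ forall k, k \notin descents com w -> P (height w k) (dheight w k),
      forall j, j \in descents com w -> P (- height w j) (- dheight w j)
    & forall k j, k \notin descents com w -> j \in descents com w ->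
        ~~ com k j -> P (height w k + height w j) (dheight w k + dheight w j)].

(** Along the recursion each quantity of a sign pattern becomes [u + c * v], where
    [u] is an old quantity, [v] the height of the new letter, and [c'] the
    velocity of [c]. *)
Definition step_closed P Q : Prop :=
  forall u u' v v' c c', P u u' -> P v v' -> 0 <= c <= K -> eta * c <= c' ->
    Q (u + c * v) (u' + c * v' + c' * v).

Lemma offdiag_ge0 i j : i != j -> 0 <= a i j.
Proof.
case: H => _ h0 h2 _ ij; have [/h0|/(h2 _ _ ij)] := boolP (com i j).
  by case=> ->.
by apply: le_trans.
Qed.

(** The coefficient [c] of the step is [0] or [a i k - e] with [e = 0, 1, 2].  The
    values 1 and 2 occur for non-commuting letters only, and there [2 <= a i k]
    makes it nonnegative. *)
Lemma sign_pattern_step P Q i w : step_closed P Q -> i \notin descents com w ->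
  sign_pattern P w -> sign_pattern Q (i :: w).
Proof.
move=> PQ iD [Pk Pj Pkj]; have Pi := Pk i iD.
case: H => hii h0 h2 hK.
have PQ1 u u' : P u u' -> Q u u'.
  move=> Pu; have := @PQ u u' _ _ 0 0 Pu Pi.
  by rewrite lexx !mul0r !addr0 mulr0 lexx K_ge0; apply.
(* Subtracting the constant e lowers the coefficient but not its velocity. *)
have PQc u u' k e : i != k -> 0 <= e -> e <= a i k -> P u u' ->
    Q (u + (a i k - e) * height w i)
      (u' + (a i k - e) * dheight w i + a' i k * height w i).
  move=> ik e0 eik Pu; have [aK ae] := hK i k ik; apply: PQ => //.
    by apply/andP; split; lra.
  by apply: le_trans ae; rewrite ler_wpM2l //; lra.
have nD k : k \notin descents com (i :: w) -> i != k /\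
    (k \notin descents com w \/ k \in descents com w /\ ~~ com i k).
  rewrite /= !inE negb_or negb_and eq_sym => /andP[ik kD]; split=> //.
  by case: (boolP (k \in _)) kD => /=; [right|left].
have inD j : j \in descents com (i :: w) ->
    j = i \/ [/\ j != i, j \in descents com w & com i j].
  rewrite /= !inE => /orP[/eqP->|/andP[jw ij]]; [by left|right; split=> //].
  by apply: contraTneq ij => ->; rewrite com_irr.
split.
- move=> k /nD[ik [kD|[kD nik]]] /=.
    have := PQc _ _ k 0 ik (lexx _) (offdiag_ge0 ik) (Pk k kD).
    by rewrite subr0.
  have ki : ~~ com i k by [].
  have := PQc _ _ k 1 ik ler01 (le_trans _ (h2 _ _ ik ki)) (Pkj i k iD kD ki).
  have -> : height w i + height w k + (a i k - 1) * height w i =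
    height w k + a i k * height w i by ring.
  have -> : dheight w i + dheight w k + (a i k - 1) * dheight w i +
    a' i k * height w i = dheight w k + a i k * dheight w i + a' i k * height w i
    by ring.
  by apply; lra.
- move=> j /inD[->|[ji jD ij]] /=.
    have [-> ->] := hii i.
    have -> : - (height w i + -2 * height w i) = height w i by ring.
    have -> : - (dheight w i + -2 * dheight w i + 0 * height w i) = dheight w i
      by ring.
    exact: PQ1.
  by have [-> ->] := h0 i j ij; rewrite !mul0r !addr0; apply/PQ1/Pj.
- move=> k j /nD[ik kD] /inD[->|[ji jD ij]] kj /=.
    have [-> ->] := hii i.
    case: kD => [kD|[kD nik]].
      have := PQc _ _ k 1 ik ler01 (le_trans _ (h2 _ _ ik _)) (Pk k kD).
      have -> : height w k + (a i k - 1) * height w i =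
        height w k + a i k * height w i + (height w i + -2 * height w i) by ring.
      have -> : dheight w k + (a i k - 1) * dheight w i + a' i k * height w i =
        dheight w k + a i k * dheight w i + a' i k * height w i +
        (dheight w i + -2 * dheight w i + 0 * height w i) by ring.
      by apply; rewrite ?ler1n // com_sym.
    have := PQc _ _ k 2 ik _ (h2 _ _ ik nik) (Pkj i k iD kD nik).
    have -> : height w i + height w k + (a i k - 2) * height w i =
      height w k + a i k * height w i + (height w i + -2 * height w i) by ring.
    have -> : dheight w i + dheight w k + (a i k - 2) * dheight w i +
      a' i k * height w i = dheight w k + a i k * dheight w i +
      a' i k * height w i + (dheight w i + -2 * dheight w i + 0 * height w i)
      by ring.
    by apply.
  have [-> ->] := h0 i j ij; rewrite !mul0r !addr0.
  case: kD => [kD|[kD nik]]; last first.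
    have kj' : k != j by apply: contraNneq nik => ->.
    by rewrite (descents_com com_sym kD jD kj') in kj.
  have := PQc _ _ k 0 ik (lexx _) (offdiag_ge0 ik) (Pkj k j kD jD kj).
  rewrite subr0 (addrAC (height w k)).
  by rewrite (addrAC (dheight w k)) (addrAC (_ + _) (dheight w j)); apply.
Qed.

Hypothesis y0_gt0 : forall k, 0 < y0 k.

Lemma sign_pattern_nil P : (forall k, P (y0 k) (y0' k)) -> sign_pattern P [::].
Proof. by move=> Py; split=> [k _|j|k j _] /=; rewrite ?inE. Qed.

Lemma sign_pattern_reduced P w : step_closed P P -> (forall k, P (y0 k) (y0' k)) ->
  reduced com w -> sign_pattern P w.
Proof.
move=> PP Py; elim: w => [|i w IH] /=; first by move=> _; apply: sign_pattern_nil.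
by move=> /andP[iD /IH]; apply: sign_pattern_step.
Qed.

Lemma height_sign w : reduced com w -> sign_pattern (fun u _ => 0 < u) w.
Proof.
apply: sign_pattern_reduced => // u u' v v' c c' u0 v0 /andP[c0 _] _.
by rewrite ltr_wpDr // mulr_ge0 // ltW.
Qed.

(** The first letter of a reduced word is a wall that separates the image of the
    base point from the base point; this makes geometric representations
    faithful. *)
Lemma height_lt0 i w : reduced com (i :: w) -> height (i :: w) i < 0.
Proof.
move=> rw; have [_ /(_ i) + _] := height_sign rw.
by rewrite /= !inE eqxx oppr_gt0; apply.
Qed.

(** * Exponential growth and the derivative *)

Hypothesis y0'_ge0 : forall k, 0 <= y0' k.

Lemma dheight_ge0 w : reduced com w -> sign_pattern (fun u u' => 0 < u /\ 0 <= u') w.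
Proof.
apply: sign_pattern_reduced => // u u' v v' c c' [u0 u'0] [v0 v'0] /andP[c0 _] cc'.
have c'0 : 0 <= c' by apply: le_trans cc'; rewrite mulr_ge0.
by rewrite ltr_wpDr ?mulr_ge0 ?(ltW v0) // !addr_ge0 // mulr_ge0 // ltW.
Qed.

(** Think of the height as a sum over chains of letters: each non-trivial step of a
    chain contributes at least [eta] to the logarithmic derivative, and the chains
    with fewer than [M] such steps are too few to matter for the exponential growth.
    The induction on [M] bounds their contribution: a step of weight [c] costs one
    unit of [M], that is a factor [q] of the error, so the error grows by a factor
    [1 + c / q <= theta] only. *)
Lemma dheight_growth (C q theta : R) (M : nat) w :
  (forall k, eta * y0 k <= C) -> 0 <= C -> 2 <= q -> 1 <= theta ->
  K <= q * (theta - 1) -> reduced com w ->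
  sign_pattern (fun u u' => M%:R * eta * u - C * q ^+ M * theta ^+ size w <= u') w.
Proof.
move=> yC C0 q2 th1 Kq.
have q0 : 0 <= q by apply: le_trans q2.
have th0 : 0 <= theta by apply: le_trans th1.
have E0 m l : 0 <= C * q ^+ m * theta ^+ l by rewrite !mulr_ge0 // exprn_ge0.
elim: M w => [|M IHM] w.
  move=> /dheight_ge0[Hk Hj Hkj]; have e0 := E0 0%N (size w).
  have weaken u u' : 0 < u /\ 0 <= u' ->
      0 * eta * u - C * q ^+ 0 * theta ^+ size w <= u'.
    by case=> _ h; apply: le_trans h; rewrite !mul0r add0r oppr_le0.
  by split=> *; apply: weaken; auto.
elim: w => [|i w IHw] /=.
  move=> _; apply: sign_pattern_nil => k; apply: le_trans (y0'_ge0 k).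
  rewrite expr0 mulr1 subr_le0 -mulrA mulrC; apply: ler_pM => //.
  - by rewrite mulr_ge0 // ltW.
  - apply: le_trans (_ : 2 ^+ M.+1 <= _); last by rewrite lerXn2r ?nnegrE.
    by rewrite -natrX ler_nat ltnW // ltn_expl.
move=> /andP[iD rw].
pose P u u' := M.+1%:R * eta * u - C * q ^+ M.+1 * theta ^+ size w <= u'
  /\ [/\ 0 < u & M%:R * eta * u - C * q ^+ M * theta ^+ size w <= u'].
apply: (@sign_pattern_step P) => //; last first.
  have [Ak Aj Akj] := IHw rw; have [Bk Bj Bkj] := IHM w rw.
  have [Ck Cj Ckj] := height_sign rw.
  by split=> *; split; auto.
move=> u u' v v' c c' [Pu _] [_ [v0 Pv]] /andP[c0 cK] cc'.
rewrite (exprS theta) (exprS q); rewrite (exprS q) in Pu.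
set E := C * q ^+ M * theta ^+ size w in Pv.
have EE : 0 <= E by apply: E0.
have -> : C * (q * q ^+ M) * (theta * theta ^+ size w) = q * theta * E
  by rewrite /E; ring.
have {}Pu : M.+1%:R * eta * u - q * E <= u'.
  by apply: le_trans Pu; rewrite lerD2l lerN2 /E le_eqVlt; apply/orP; left; apply/eqP; ring.
have H1 : c * (M%:R * eta * v - E) <= c * v' by rewrite ler_wpM2l.
have H2 : eta * c * v <= c' * v by rewrite ler_wpM2r // ltW.
have H3 : c * E <= q * (theta - 1) * E by rewrite ler_wpM2r //; apply: le_trans Kq.
apply: le_trans (_ : M.+1%:R * eta * u - q * E + c * (M%:R * eta * v - E) +
   eta * c * v <= _); last by rewrite !lerD.
rewrite -natr1; lra.
Qed.

(** A letter that does not commute with some descents multiplies the height of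
    each of them by at least [1 + b >= kap ^ 2] in absolute value and turns them
    into non-descents; a letter that commutes with all of them adds a descent.
    Weighting the descents by [kap] makes the product grow at every step. *)
Lemma height_exp_growth (b kap : R) w :
  (forall i j, i != j -> ~~ com i j -> 2 + b <= a i j) ->
  1 <= kap -> kap ^+ 2 <= 1 + b -> reduced com w ->
  kap ^+ size w * \prod_k y0 k <=
    \prod_k (`|height w k| * (if k \in descents com w then kap else 1)).
Proof.
move=> hb kap1 kapb; have kap0 : 0 <= kap by apply: le_trans kap1.
have kap2 : kap <= kap ^+ 2 by rewrite expr2 ler_peMr.
elim: w => [_|i w IH rw].
  rewrite expr0 mul1r le_eqVlt; apply/orP; left; apply/eqP; apply: eq_bigr => k _ /=.
  by rewrite inE mulr1 gtr0_norm.
have /andP[iD rw'] := rw; have [Hk Hj Hkj] := height_sign rw'.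
rewrite /= exprS -mulrA; apply: le_trans (ler_wpM2l kap0 (IH rw')) _.
rewrite (bigD1 i) //= [leRHS](bigD1 i) //= (negbTE iD) !inE eqxx /=.
case: (H) => hii h0 h2 hK; have [-> _] := hii i.
rewrite (_ : height w i + -2 * height w i = - height w i); last by ring.
rewrite mulr1 normrN mulrA (mulrC kap); apply: ler_wpM2l; first exact: mulr_ge0.
apply: ler_prod => k ki; rewrite !inE (negbTE ki) /=.
rewrite mulr_ge0 //=; last by case: ifP.
have ik : i != k by rewrite eq_sym.
have yi := Hk i iD; have ai0 := offdiag_ge0 ik.
have [kD|kD] := boolP (k \in descents com w) => /=; last first.
  have yk := Hk k kD; have ay : 0 <= a i k * height w i by rewrite mulr_ge0 // ltW.
  by rewrite !mulr1 !ger0_norm ?lerDl // ?addr_ge0 // ltW.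
have [ck|nck] := boolP (com i k); first by have [-> _] := h0 _ _ ck; rewrite mul0r addr0.
have yk := Hj k kD; have yik := Hkj i k iD kD nck.
have ab := hb i k ik nck; rewrite oppr_gt0 in yk.
have b0 : 0 <= b by rewrite -(lerD2l 1) addr0; apply: le_trans kapb; apply: le_trans kap2.
rewrite mulr1 (ltr0_norm yk).
have h1 : (1 + b) * - height w k <= (1 + b) * height w i.
  by rewrite ler_wpM2l ?addr_ge0 // lerNl; lra.
have h2' : (2 + b) * height w i <= a i k * height w i by rewrite ler_wpM2r // ltW.
have h3 : - height w k * kap <= - height w k * (1 + b).
  by rewrite ler_wpM2l ?(le_trans kap2) // oppr_ge0 ltW.
apply: le_trans (ler_norm _).
by apply: le_trans h3 _; lra.
Qed.

End Growth.

Lemma exp_unbounded (R : realType) (x C : R) : 1 < x ->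
  exists L : nat, forall l, x ^+ l <= C -> (l <= L)%N.
Proof.
move=> x1; have bern l : 1 + l%:R * (x - 1) <= x ^+ l.
  elim: l => [|l IH]; first by rewrite mul0r addr0 expr0.
  rewrite exprS -natr1; have x0 : 0 <= x by apply: ltW; apply: lt_trans x1.
  apply: le_trans (ler_wpM2l x0 IH); rewrite -subr_ge0.
  rewrite (_ : _ - _ = l%:R * (x - 1) ^+ 2); last by ring.
  by rewrite mulr_ge0 // sqr_ge0.
exists (Num.bound (C / (x - 1))) => l /(le_trans (bern l)) lC.
have xp : 0 < x - 1 by rewrite subr_gt0.
have : l%:R <= C / (x - 1) by rewrite ler_pdivlMr //; lra.
move=> h; rewrite -(ler_nat R); apply: (le_trans h).
by apply/ltW/archi_boundP/(le_trans _ h).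
Qed.

Lemma small_root (R : realType) (b : R) n : 0 < b ->
  exists2 x : R, 1 < x & x ^+ n.+1 <= 1 + b.
Proof.
move=> b0; have b1 : 0 < 1 + b by rewrite addr_gt0.
exists (expR (ln (1 + b) / n.+1%:R)).
  by rewrite -[ltLHS]expR0 ltr_expR divr_gt0 // ln_gt0 // ltrDl.
by rewrite -expRM_natl mulrCA divff ?pnatr_eq0 // mulr1 lnK.
Qed.

Section LengthBound.
Context {R : realType} {S : finType} (com : rel S).
Hypothesis com_sym : symmetric com.
Hypothesis com_irr : irreflexive com.
Variables (a a' : S -> S -> R) (y0 y0' : S -> R) (eta K b : R).
Hypothesis H : expanding_gram com a a' eta K.
Hypothesis Hb : forall i j, i != j -> ~~ com i j -> 2 + b <= a i j.
Hypothesis eta_gt0 : 0 < eta.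
Hypothesis K_ge0 : 0 <= K.
Hypothesis b_gt0 : 0 < b.
Hypothesis y0_gt0 : forall k, 0 < y0 k.
Hypothesis y0'_ge0 : forall k, 0 <= y0' k.

(** Take [F] of the order of the largest height and [l] the length of [w].  If the
    derivative is at most a multiple of [F], then dheight_growth bounds [F] by a
    multiple of [theta ^ l], and the product of the heights by one of
    [theta ^ (l * #|S|)]; but this product grows like [theta ^ (l * (#|S| + 1))]. *)
Lemma length_bound (A B D : R) : 0 <= A -> 0 < B -> 0 <= D ->
  exists L : nat, forall w F k, reduced com w -> k \notin descents com w ->
    0 <= F -> (forall j, `|height a y0 w j| <= A * F) ->
    F <= B * height a y0 w k -> dheight a a' y0 y0' w k <= D * F ->
    (size w <= L)%N.
Proof.
move=> A0 B0 D0.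
have [theta th1 thb] := @small_root R b (#|S|.+1 * 2).-1 b_gt0.
have th0 : 0 < theta by apply: lt_trans th1.
rewrite prednK ?muln_gt0 // exprM in thb.
set kap := theta ^+ #|S|.+1 in thb.
have kap1 : 1 <= kap by rewrite exprn_ege1 // ltW.
have kap0 : 0 <= kap by apply: le_trans kap1.
pose q := 2 + K / (theta - 1).
have thp : 0 < theta - 1 by rewrite subr_gt0.
have q2 : 2 <= q by rewrite lerDl divr_ge0 // ltW.
have Kq : K <= q * (theta - 1).
  by rewrite mulrDl divfK ?gt_eqF // lerDr mulr_ge0 // ltW.
pose C := \sum_k eta * y0 k.
have y0p k : 0 <= eta * y0 k by rewrite mulr_ge0 // ltW.
have C0 : 0 <= C by apply: sumr_ge0.
have yC k : eta * y0 k <= C by rewrite /C (bigD1 k) //= lerDl sumr_ge0.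
have [M HM] : exists M : nat, D * B + 1 <= M%:R * eta.
  exists (Num.bound ((D * B + 1) / eta)); rewrite -ler_pdivrMr //.
  by apply/ltW/archi_boundP; rewrite divr_ge0 ?addr_ge0 ?mulr_ge0 // ltW.
pose G := B * (C * q ^+ M).
have q0 : 0 <= q by apply: le_trans q2.
have G0 : 0 <= G by rewrite !mulr_ge0 ?exprn_ge0 // ltW.
pose Y := \prod_k y0 k.
have Y0 : 0 < Y by apply: prodr_gt0.
have [L HL] := @exp_unbounded R theta ((A * G * kap) ^+ #|S| / Y) th1.
exists L => w F k rw kD F0 HA HB HD; apply: HL; rewrite ler_pdivlMr //.
have [Gk _ _] := dheight_growth com_sym com_irr H (ltW eta_gt0) K_ge0 y0_gt0
  y0'_ge0 M yC C0 q2 (ltW th1) Kq rw.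
have {Gk} /= := Gk k kD; set y := height _ _ _ _ in HB * => Gk.
have y_ge0 : 0 <= y by rewrite -(pmulr_rge0 _ B0); apply: le_trans HB.
have FG : F <= G * theta ^+ size w.
  apply: (le_trans HB); rewrite /G -mulrA ler_pM2l //.
  have h1 : D * F <= D * (B * y) by rewrite ler_wpM2l.
  have h2 : (D * B + 1) * y <= M%:R * eta * y by rewrite ler_wpM2r.
  move: h1 h2 Gk HD; move: (dheight _ _ _ _ _ _) (theta ^+ _) (q ^+ M) => y' t r.
  lra.
have := height_exp_growth com_sym com_irr y0' H (ltW eta_gt0) K_ge0 y0_gt0 Hb kap1 thb rw.
move=> h; have {h} := le_trans h _; move=> /(_ ((A * G * kap * theta ^+ size w) ^+ #|S|)).
have step : \prod_j (`|height a y0 w j| * (if j \in descents com w then kap else 1))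
    <= (A * G * kap * theta ^+ size w) ^+ #|S|.
  rewrite -prodr_const; apply: ler_prod => j _; apply/andP; split.
    by rewrite mulr_ge0 //; case: ifP.
  have -> : A * G * kap * theta ^+ size w = A * (G * theta ^+ size w) * kap by ring.
  apply: ler_pM => //; first by case: ifP.
    by apply: le_trans (HA j) _; rewrite ler_wpM2l.
  by case: ifP.
move=> /(_ step); rewrite -/Y exprMn -!exprM mulSn (mulnC #|S|) exprD => h.
rewrite -(ler_pM2r (exprn_gt0 (size w * #|S|) th0)).
by rewrite mulrAC.
Qed.

End LengthBound.

(** * Lorentzian linear algebra *)

Section LorentzTheory.
Context {R : realType} {n : nat}.
Implicit Types (x y z v w : 'cV[R]_(n + 1)) (g h : 'M[R]_(n + 1)).
Local Notation J := (@lorentz_mx R n).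

Lemma trmx_lorentz_mx : J^T = J.
Proof. by rewrite /lorentz_mx tr_block_mx !linear0 linearN /= !trmx1. Qed.

Lemma lorentzC x y : lorentz x y = lorentz y x.
Proof.
rewrite /lorentz; have -> (A : 'M[R]_1) : A 0 0 = A^T 0 0 by rewrite mxE.
by rewrite !trmx_mul trmxK trmx_lorentz_mx mulmxA.
Qed.

Lemma lorentzDr x y z : lorentz x (y + z) = lorentz x y + lorentz x z.
Proof. by rewrite /lorentz mulmxDr mxE. Qed.

Lemma lorentzZr x c y : lorentz x (c *: y) = c * lorentz x y.
Proof. by rewrite /lorentz -scalemxAr mxE. Qed.

Lemma lorentzDl x y z : lorentz (y + z) x = lorentz y x + lorentz z x.
Proof. by rewrite lorentzC lorentzDr !(lorentzC x). Qed.

Lemma lorentzZl x c y : lorentz (c *: y) x = c * lorentz y x.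
Proof. by rewrite lorentzC lorentzZr lorentzC. Qed.

Lemma lorentz0r x : lorentz x 0 = 0.
Proof. by rewrite -[0](scale0r 0) lorentzZr mul0r. Qed.

Lemma lorentz0l x : lorentz 0 x = 0.
Proof. by rewrite lorentzC lorentz0r. Qed.

Lemma lorentzNr x y : lorentz x (- y) = - lorentz x y.
Proof. by rewrite -scaleN1r lorentzZr mulN1r. Qed.

Lemma lorentzNl x y : lorentz (- y) x = - lorentz y x.
Proof. by rewrite -scaleN1r lorentzZl mulN1r. Qed.

Definition lorentzE := (lorentzDl, lorentzDr, lorentzZl, lorentzZr, lorentzNl, lorentzNr).

Lemma lorentz_sumr x (I : Type) (r : seq I) (F : I -> 'cV[R]_(n + 1)) :
  lorentz x (\sum_(i <- r) F i) = \sum_(i <- r) lorentz x (F i).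
Proof.
elim: r => [|i r IH]; first by rewrite !big_nil lorentz0r.
by rewrite !big_cons lorentzDr IH.
Qed.

Lemma lorentz_col_mx (p q : 'cV[R]_n) (r s : 'cV[R]_1) :
  lorentz (col_mx p r) (col_mx q s) = (p^T *m q) 0 0 - r 0 0 * s 0 0.
Proof.
rewrite /lorentz tr_col_mx /lorentz_mx mul_row_block !mulmx1 !mulmx0 addr0 add0r.
rewrite mul_row_col mulmxN mulmx1 mulNmx !mxE; congr (_ - _).
by rewrite big_ord1 mxE.
Qed.

Lemma lorentz_sum_sqr x :
  lorentz x x = \sum_i x (lshift 1 i) 0 ^+ 2 - x (rshift n 0) 0 ^+ 2.
Proof.
rewrite -{1 2}[x]vsubmxK lorentz_col_mx !mxE expr2; congr (_ - _).
by apply: eq_bigr => i _; rewrite !mxE expr2.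
Qed.

Lemma mul_row_lorentz v w x : v *m w^T *m J *m x = lorentz w x *: v.
Proof.
rewrite -!mulmxA (mulmxA w^T) [w^T *m J *m x]mx11_scalar -/(lorentz w x).
by rewrite mul_mx_scalar.
Qed.

Lemma mulmx_ext g h : (forall x, g *m x = h *m x) -> g = h.
Proof.
move=> gh; apply/matrixP => i j.
have /matrixP/(_ i 0) := gh (delta_mx j 0).
by rewrite -!colE !mxE.
Qed.

Lemma reflection_mulE v x :
  reflection_mx v *m x = x - (2 / lorentz v v * lorentz v x) *: v.
Proof.
by rewrite /reflection_mx mulmxBl mul1mx -scalemxAl mul_row_lorentz scalerA.
Qed.

Lemma reflection_mulE1 v x : lorentz v v = 1 ->
  reflection_mx v *m x = x - (2 * lorentz v x) *: v.
Proof. by move=> v1; rewrite reflection_mulE v1 divr1. Qed.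

Lemma reflection_mx_scale c v : c != 0 -> reflection_mx (c *: v) = reflection_mx v.
Proof.
move=> c0; rewrite /reflection_mx !lorentzE.
have -> : (c *: v) *m (c *: v)^T = (c * c) *: (v *m v^T).
  by rewrite [(c *: v)^T]linearZ /= -scalemxAl -scalemxAr scalerA.
rewrite -scalemxAl scalerA; congr (_ - _ *: _).
have [->|v0] := eqVneq (lorentz v v) 0; first by rewrite !mulr0 invr0 !mulr0 !mul0r.
by field; rewrite c0 v0.
Qed.

Lemma indef_orthP g :
  indef_orth n g <-> forall x y, lorentz (g *m x) (g *m y) = lorentz x y.
Proof.
have E x y : lorentz (g *m x) (g *m y) = (x^T *m (g^T *m J *m g) *m y) 0 0.
  by rewrite /lorentz trmx_mul !mulmxA.
split=> [gJ x y|H]; first by rewrite E gJ.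
apply/matrixP => i j.
have := H (delta_mx i 0) (delta_mx j 0); rewrite E /lorentz trmx_delta.
by rewrite -!rowE -!colE !mxE.
Qed.

Lemma indef_orth_lieP g :
  indef_orth_lie n g <-> forall x y, lorentz (g *m x) y + lorentz x (g *m y) = 0.
Proof.
have E x y : lorentz (g *m x) y + lorentz x (g *m y) =
    (x^T *m (g^T *m J + J *m g) *m y) 0 0.
  by rewrite /lorentz trmx_mul mulmxDr mulmxDl !mulmxA [RHS]mxE.
split=> [gJ x y|H]; first by rewrite E gJ mulmx0 mul0mx mxE.
apply/matrixP => i j.
have := H (delta_mx i 0) (delta_mx j 0); rewrite E trmx_delta.
by rewrite -rowE -colE !mxE.
Qed.

End LorentzTheory.

(** * Reflections and their first-order deformations *)

Section Reflections.
Context {R : realType} {n : nat}.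
Implicit Types (x y z v w : 'cV[R]_(n + 1)) (g h : 'M[R]_(n + 1)).
Local Notation J := (@lorentz_mx R n).

(** The derivative of [reflection_mx v] when the unit vector [v] moves with
    velocity [v']. *)
Definition dreflection_mx v v' : 'M[R]_(n + 1) :=
  - (2 *: ((v' *m v^T + v *m v'^T) *m J)).

Lemma dreflection_mulE v v' x : dreflection_mx v v' *m x =
  - ((2 * lorentz v x) *: v' + (2 * lorentz v' x) *: v).
Proof.
rewrite /dreflection_mx mulNmx -scalemxAl 2!mulmxDl !mul_row_lorentz.
by rewrite scalerDr !scalerA.
Qed.

(** The matrix [g + epsilon g'] over the dual numbers, where [epsilon ^ 2 = 0]. *)
Definition dual_mx g g' : 'M[R]_((n + 1) + (n + 1)) := block_mx g g' 0 g.

Lemma mul_dual_mx g g' h h' :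
  dual_mx g g' *m dual_mx h h' = dual_mx (g *m h) (g *m h' + g' *m h).
Proof. by rewrite mulmx_block !mul0mx !mulmx0 !addr0 add0r. Qed.

Lemma reflection_mxK v : lorentz v v = 1 -> reflection_mx v *m reflection_mx v = 1%:M.
Proof.
move=> v1; apply: mulmx_ext => x; rewrite mul1mx -mulmxA !reflection_mulE1 //.
rewrite !lorentzE v1; apply/matrixP => i j; rewrite !mxE; ring.
Qed.

Lemma reflection_mxC v w : lorentz v v = 1 -> lorentz w w = 1 -> lorentz v w = 0 ->
  reflection_mx v *m reflection_mx w = reflection_mx w *m reflection_mx v.
Proof.
move=> v1 w1 vw; apply: mulmx_ext => x; rewrite -!mulmxA !reflection_mulE1 //.
rewrite !lorentzE vw (lorentzC w v) vw; apply/matrixP => i j; rewrite !mxE; ring.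
Qed.

Lemma dual_reflectionK v v' : lorentz v v = 1 -> lorentz v v' = 0 ->
  dual_mx (reflection_mx v) (dreflection_mx v v') *m
  dual_mx (reflection_mx v) (dreflection_mx v v') = 1%:M.
Proof.
move=> v1 vv'; rewrite mul_dual_mx reflection_mxK //.
rewrite (_ : _ + _ = 0) /dual_mx -?scalar_mx_block //.
apply: mulmx_ext => x; rewrite mul0mx mulmxDl -!mulmxA !dreflection_mulE.
rewrite !reflection_mulE1 // !lorentzE (lorentzC v' v) vv' v1.
apply/matrixP => i j; rewrite !mxE; ring.
Qed.

Lemma dual_reflectionC v v' w w' : lorentz v v = 1 -> lorentz w w = 1 ->
  lorentz v w = 0 -> lorentz v' w + lorentz v w' = 0 ->
  dual_mx (reflection_mx v) (dreflection_mx v v') *m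
  dual_mx (reflection_mx w) (dreflection_mx w w') =
  dual_mx (reflection_mx w) (dreflection_mx w w') *m
  dual_mx (reflection_mx v) (dreflection_mx v v').
Proof.
move=> v1 w1 vw vw'; rewrite !mul_dual_mx (reflection_mxC v1 w1 vw).
suff -> : reflection_mx v *m dreflection_mx w w' + dreflection_mx v v' *m reflection_mx w =
  reflection_mx w *m dreflection_mx v v' + dreflection_mx w w' *m reflection_mx v by [].
apply: mulmx_ext => x; rewrite [LHS]mulmxDl [RHS]mulmxDl -!mulmxA !dreflection_mulE.
rewrite !reflection_mulE1 // !lorentzE (lorentzC w v) vw.
rewrite ?(lorentzC w v') ?(lorentzC w' v) (_ : lorentz v' w = - lorentz v w'); last first.
  by apply/eqP; rewrite -addr_eq0 vw'.
apply/matrixP => i j; rewrite !mxE; ring.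
Qed.

(** [g'] is a tangent vector at [g] of the isometry group. *)
Definition isometry_germ g g' : Prop := forall x y,
  lorentz (g *m x) (g *m y) = lorentz x y /\
  lorentz (g' *m x) (g *m y) + lorentz (g *m x) (g' *m y) = 0.

Lemma reflection_germ v v' : lorentz v v = 1 -> lorentz v v' = 0 ->
  isometry_germ (reflection_mx v) (dreflection_mx v v').
Proof.
move=> v1 vv' x y; rewrite !dreflection_mulE !reflection_mulE1 // !lorentzE.
rewrite (lorentzC v' v) vv' v1 !(lorentzC x).
by split; ring.
Qed.

Lemma isometry_germM g g' h h' : isometry_germ g g' -> isometry_germ h h' ->
  isometry_germ (g *m h) (g *m h' + g' *m h).
Proof.
move=> Hg Hh x y; split; first by rewrite -!mulmxA (Hg _ _).1 (Hh _ _).1.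
rewrite !(mulmxDl _ _ x) !(mulmxDl _ _ y) -!mulmxA !lorentzE.
have [_ g1] := Hg (h *m x) (h *m y); have [_ h1] := Hh x y.
have [g2 _] := Hg (h' *m x) (h *m y); have [g3 _] := Hg (h *m x) (h' *m y).
by rewrite g2 g3 addrACA g1 h1 addr0.
Qed.

Lemma germ_lie g g' : isometry_germ g g' -> g \in unitmx ->
  indef_orth_lie n (g' *m invmx g).
Proof.
move=> Hg gu; apply/indef_orth_lieP => x y.
have [_] := Hg (invmx g *m x) (invmx g *m y).
by rewrite !mulmxA mulmxV // !mul1mx.
Qed.

(** * Matrix bounds *)

Definition mx_bounded p q (A : 'M[R]_(p, q)) (c : R) := forall i j, `|A i j| <= c.

Lemma mx_boundedM p q r (A : 'M[R]_(p, q)) (B : 'M[R]_(q, r)) a b :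
  mx_bounded A a -> mx_bounded B b -> mx_bounded (A *m B) (q%:R * (a * b)).
Proof.
move=> HA HB i j; rewrite mxE; apply: le_trans (ler_norm_sum _ _ _) _.
apply: le_trans (_ : \sum_(k < q) a * b <= _); last first.
  by rewrite sumr_const card_ord mulr_natl.
by apply: ler_sum => k _; rewrite normrM; apply: ler_pM.
Qed.

Lemma mx_boundedB p q (A B : 'M[R]_(p, q)) a b :
  mx_bounded A a -> mx_bounded B b -> mx_bounded (A - B) (a + b).
Proof.
move=> HA HB i j; rewrite !mxE; apply: le_trans (ler_normB _ _) _.
exact: lerD.
Qed.

Lemma lorentz_mx_bounded : mx_bounded J 1.
Proof.
move=> i j; rewrite /lorentz_mx -(splitK i) -(splitK j).
case: (fintype.split i) => a; case: (fintype.split j) => b /=;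
  rewrite ?block_mxEul ?block_mxEur ?block_mxEdl ?block_mxEdr !mxE ?normr0 //.
  by case: (a == b); rewrite ?normr1 ?normr0.
by case: (a == b); rewrite ?normrN ?normr1 ?normr0 // oppr0 normr0.
Qed.

Lemma lorentz_bounded x y a b : mx_bounded x a -> mx_bounded y b ->
  `|lorentz x y| <= (n + 1)%:R * ((n + 1)%:R * (a * 1) * b).
Proof.
move=> Hx Hy; apply: mx_boundedM => //; apply: mx_boundedM lorentz_mx_bounded.
by move=> i j; rewrite mxE.
Qed.

Definition basepoint : 'cV[R]_(n + 1) := delta_mx (rshift n 0) 0.

Lemma basepointE : basepoint = col_mx 0 1%:M.
Proof.
apply/matrixP => i j; rewrite !ord1 -(splitK i).
case: (fintype.split i) => a /=; rewrite ?col_mxEu ?col_mxEd !mxE.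
  by rewrite eq_lrshift.
by rewrite !ord1 !eqxx.
Qed.

Lemma lorentz_basepointE x : lorentz x basepoint = - x (rshift n 0) 0.
Proof.
by rewrite basepointE -{1}[x]vsubmxK lorentz_col_mx mulmx0 !mxE sub0r mulr1.
Qed.

Lemma lorentz_basepoint2 : lorentz basepoint basepoint = -1.
Proof. by rewrite lorentz_basepointE mxE !eqxx. Qed.

Lemma spatial_le x (i : 'I_n) :
  x (lshift 1 i) 0 ^+ 2 <= lorentz x x + x (rshift n 0) 0 ^+ 2.
Proof.
rewrite lorentz_sum_sqr addrNK (bigD1 i) //= lerDl.
by apply: sumr_ge0 => j _; apply: sqr_ge0.
Qed.

Lemma lorentz_delta_spatial (i : 'I_n) :
  lorentz (delta_mx (lshift 1 i) 0 : 'cV[R]_(n + 1)) (delta_mx (lshift 1 i) 0) = 1.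
Proof.
rewrite lorentz_sum_sqr mxE eq_rlshift expr0n subr0 (bigD1 i) //= big1.
  by rewrite addr0 mxE !eqxx expr1n.
by move=> j ji; rewrite mxE eq_lshift (negbTE ji) expr0n.
Qed.

Lemma indef_orth_tr g : indef_orth n g -> indef_orth n g^T.
Proof.
move=> gJ; have JJ : J *m J = 1%:M.
  rewrite /lorentz_mx mulmx_block !mulmx0 !mul0mx !addr0 add0r mulmx1.
  by rewrite mulmxN mulmx1 opprK -scalar_mx_block.
have : (J *m g^T *m J) *m g = 1%:M by rewrite -2!mulmxA (mulmxA g^T) gJ JJ.
move=> /mulmx1C /(congr1 (mulmx^~ J)); rewrite /indef_orth /= trmxK mul1mx.
by rewrite !mulmxA -(mulmxA _ J J) JJ mulmx1.
Qed.

(** Isometries are controlled by the hyperbolic displacement of the base point,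
    whose hyperbolic cosine is the last diagonal entry. *)
Lemma indef_orth_bounded g : indef_orth n g ->
  mx_bounded g `|g (rshift n 0) (rshift n 0)|.
Proof.
move=> gO; have /indef_orthP gP := gO; have /indef_orthP gtP := indef_orth_tr gO.
have sqr_le (a b : R) : a ^+ 2 <= b ^+ 2 -> `|a| <= `|b|.
  by move=> ab; rewrite -ler_sqr ?nnegrE // !real_normK ?num_real.
have H1 i : g (lshift 1 i) (rshift n 0) ^+ 2 <= g (rshift n 0) (rshift n 0) ^+ 2 - 1.
  have := spatial_le (g *m basepoint) i.
  by rewrite gP lorentz_basepoint2 /basepoint -colE !mxE addrC.
have H2 i j : g i (lshift 1 j) ^+ 2 <=
    lorentz (delta_mx i 0 : 'cV[R]_(n + 1)) (delta_mx i 0) + g i (rshift n 0) ^+ 2.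
  by have := spatial_le (g^T *m delta_mx i 0) j; rewrite gtP -colE !mxE.
move=> i j; apply: sqr_le; rewrite -(splitK i) -(splitK j).
case: (fintype.split i) => a; case: (fintype.split j) => b /=.
- by apply: le_trans (H2 _ _) _; rewrite lorentz_delta_spatial; have := H1 a; lra.
- by rewrite !ord1; apply: le_trans (H1 _) _; rewrite gerBl.
- rewrite !ord1; apply: le_trans (H2 _ _) _.
  by rewrite -/basepoint lorentz_basepoint2 gerDr lerN10.
- by rewrite !ord1.
Qed.

End Reflections.

Lemma fin_bounded (R : realType) (T : finType) p q (f : T -> 'M[R]_(p, q)) :
  exists2 c, 0 <= c & forall t, mx_bounded (f t) c.
Proof.
exists (\sum_t \sum_i \sum_j `|f t i j|).
  by apply: sumr_ge0 => t _; apply: sumr_ge0 => i _; apply: sumr_ge0.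
move=> t i j; rewrite (bigD1 t) //= (bigD1 i) //= (bigD1 j) //= -!addrA lerDl.
by rewrite !addr_ge0 // !sumr_ge0 // => ? _; rewrite ?sumr_ge0 // => ? _; rewrite sumr_ge0.
Qed.

Lemma compact_mx_bounded (R : realType) p q (C : set 'M[R]_(p, q)) : compact C ->
  exists2 c, 0 <= c & forall X, C X -> mx_bounded X c.
Proof.
move=> Cc; have H i j : exists c, forall X, C X -> `|X i j| <= c.
  have : compact ((fun X : 'M[R]_(p, q) => X i j) @` C).
    by apply: continuous_compact => //; apply/continuous_subspaceT/coord_continuous.
  move=> /compact_bounded[M [_ /(_ (M + 1))]]; rewrite ltrDl => /(_ ltr01) HM.
  by exists (M + 1) => X CX; apply: HM; exists X.
have /choice[f Hf] ij := H ij.1 ij.2.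
exists (\sum_ij `|f ij|) => [|X CX i j]; first exact: sumr_ge0.
rewrite (bigD1 (i, j)) //=; apply: le_trans (Hf (i, j) X CX) _ => /=.
by apply: le_trans (ler_norm _) _; rewrite lerDl sumr_ge0.
Qed.

(** * Reflection groups acting on Lorentzian space *)

Definition reflections (R : realType) (S : finType) n (v : S -> 'cV[R]_(n + 1)) i :=
  reflection_mx (v i).

Section ReflectionGroup.
Context {R : realType} {S : finType} (com : rel S) {n : nat}.
Hypothesis com_sym : symmetric com.
Hypothesis com_irr : irreflexive com.
Variable v : S -> 'cV[R]_(n + 1).

(** Unit normals of walls that cross at right angles if [com] holds and do not
    meet inside hyperbolic space otherwise. *)
Definition coxeter_normals : Prop :=
  [/\ forall i, lorentz (v i) (v i) = 1,
      forall i j, com i j -> lorentz (v i) (v j) = 0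
    & forall i j, i != j -> ~~ com i j -> lorentz (v i) (v j) <= -1].

Definition gram_entry i j : R := - 2 * lorentz (v i) (v j).

Lemma height_lorentz (x : 'cV[R]_(n + 1)) (w : seq S) k :
  (forall i, lorentz (v i) (v i) = 1) ->
  height gram_entry (fun i => - lorentz x (v i)) w k =
  - lorentz (word_mx (reflections v) w *m x) (v k).
Proof.
move=> v1; elim: w k => [|i w IH] k /=; first by rewrite mul1mx.
rewrite !IH -mulmxA reflection_mulE1 // /gram_entry !lorentzE.
rewrite (lorentzC (v i) (_ *m x)); ring.
Qed.

Hypothesis vC : coxeter_normals.

Lemma reflections_coxeter : coxeter_rep com (reflections v).
Proof.
case: vC => v1 v0 _; split=> [i|i j ij]; first exact: reflection_mxK.
exact: reflection_mxC (v1 i) (v1 j) (v0 i j ij).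
Qed.

Lemma gram_entry_expanding :
  exists2 K, 0 <= K & expanding_gram com gram_entry (fun _ _ => 0) 0 K.
Proof.
case: vC => v1 v0 v2.
have [K K0 HK] := fin_bounded (fun ij : S * S => (gram_entry ij.1 ij.2)%:M : 'M[R]_1).
exists K => //; split=> [i|i j ij|i j ij nij|i j ij].
- by rewrite /gram_entry v1 mulr1.
- by rewrite /gram_entry v0 // mulr0.
- by rewrite /gram_entry; have := v2 i j ij nij; lra.
- rewrite mul0r; split=> //; apply: le_trans (ler_norm _) _.
  by have := HK (i, j) 0 0; rewrite mxE mulr1n.
Qed.

Lemma reduced_word_neq1 (x : 'cV[R]_(n + 1)) (w : seq S) :
  (forall i, lorentz x (v i) < 0) -> reduced com w ->
  word_mx (reflections v) w = 1%:M -> w = [::].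
Proof.
case: w => // i w xv rw w1.
have [K K0 HK] := gram_entry_expanding.
have y0 k : 0 < - lorentz x (v k) by rewrite oppr_gt0.
have := height_lt0 com_sym com_irr (fun=> 0) HK (lexx 0) K0 y0 rw.
rewrite height_lorentz; last by case: vC.
by rewrite w1 mul1mx oppr_lt0 ltNge ltW // xv.
Qed.

(** The reflections in the walls [v] satisfy no relations beyond the Coxeter
    ones: any word trivial for them reduces to the empty word. *)
Lemma word_mx_kernel (x : 'cV[R]_(n + 1)) N (f : S -> 'M[R]_N) (w1 w2 : seq S) :
  (forall i, lorentz x (v i) < 0) -> coxeter_rep com f ->
  word_mx (reflections v) w1 = word_mx (reflections v) w2 ->
  word_mx f w1 = word_mx f w2.
Proof.
move=> xv cf e12; have cv := reflections_coxeter.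
have [w rw ew] := reduced_word com (rev w1 ++ w2).
have w0 : w = [::].
  apply: reduced_word_neq1 xv rw _; rewrite -ew // word_mx_cat -e12.
  exact: word_mx_rev cv.
have := ew R N f cf; rewrite w0 /= word_mx_cat => h.
have /mulmx1C h1 := word_mx_rev w1 cf.
by rewrite -[LHS]mulmx1 -h mulmxA h1 mul1mx.
Qed.

End ReflectionGroup.

Lemma generated_word (R : realType) (T : finType) n (f : T -> 'M[R]_(n + 1)) (r : rel T)
    (G : set 'M[R]_(n + 1)) A :
  coxeter_rep r f -> (forall B, G B -> exists i, B = f i) -> Defs.generated G A ->
  exists w, A = word_mx f w.
Proof.
move=> cf HG; elim=> [B /HG[i ->]||B C _ [w1 ->] _ [w2 ->]|B _ [w ->]].
- by exists [:: i]; rewrite /= mulmx1.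
- by exists [::].
- by exists (w1 ++ w2); rewrite word_mx_cat.
- by exists (rev w); rewrite (word_mx_inv _ cf).
Qed.

Section Deformation.
Context {R : realType} {S : finType} (com : rel S) {n : nat}.
Hypothesis com_sym : symmetric com.
Hypothesis com_irr : irreflexive com.
Variables (al al' : S -> 'cV[R]_(n + 1)) (eta b c : R) (ws : seq S).
Local Notation x0 := (@basepoint R n).

Definition dgram_entry i j : R :=
  - 2 * (lorentz (al' i) (al j) + lorentz (al i) (al' j)).

(** A first-order deformation [al'] of Coxeter normals which keeps the right
    angles and pushes all other pairs of walls apart, at a relative speed at
    least [eta]. *)
Definition expanding_normals : Prop :=
  [/\ coxeter_normals com al,
      forall i, lorentz (al i) (al' i) = 0,
      forall i j, com i j -> dgram_entry i j = 0,
      forall i j, i != j -> ~~ com i j ->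
        2 + b <= gram_entry al i j /\ eta * gram_entry al i j <= dgram_entry i j
    & forall i, lorentz x0 (al i) < 0 /\ lorentz x0 (al' i) <= 0].

Hypothesis alE : expanding_normals.
Hypothesis eta_gt0 : 0 < eta.
Hypothesis b_gt0 : 0 < b.
Hypothesis c_gt0 : 0 < c.
Hypothesis sum_al : \sum_(i <- ws) al i = c *: x0.

Fixpoint dword_mx (w : seq S) : 'M[R]_(n + 1) :=
  if w is i :: w' then
    reflections al i *m dword_mx w' +
    dreflection_mx (al i) (al' i) *m word_mx (reflections al) w'
  else 0.

Definition dual_reflections i := dual_mx (reflections al i) (dreflection_mx (al i) (al' i)).

Lemma word_dual_mx w :
  word_mx dual_reflections w = dual_mx (word_mx (reflections al) w) (dword_mx w).
Proof.
elim: w => [|i w IH] /=; first by rewrite /dual_mx -scalar_mx_block.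
by rewrite IH mul_dual_mx.
Qed.

Lemma dual_reflections_coxeter : coxeter_rep com dual_reflections.
Proof.
case: alE => [[v1 v0 v2] va1 va0 _ _]; split=> [i|i j ij].
  exact: dual_reflectionK.
apply: dual_reflectionC => //; first exact: v0.
have := va0 i j ij; rewrite /dgram_entry => /eqP; rewrite mulf_eq0 oppr_eq0 pnatr_eq0.
by move=> /eqP.
Qed.

Lemma dheight_lorentz w k :
  dheight (gram_entry al) dgram_entry (fun i => - lorentz x0 (al i))
    (fun i => - lorentz x0 (al' i)) w k =
  - (lorentz (dword_mx w *m x0) (al k) +
     lorentz (word_mx (reflections al) w *m x0) (al' k)).
Proof.
have [[v1 _ _] _ _ _ _] := alE.
elim: w k => [|i w IH] k /=; first by rewrite mul1mx mul0mx lorentz0l add0r.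
rewrite !IH height_lorentz // mulmxDl -!mulmxA reflection_mulE1 //.
rewrite reflection_mulE1 // dreflection_mulE /gram_entry /dgram_entry !lorentzE.
rewrite !(lorentzC (al i) (_ *m _)) !(lorentzC (al' i) (_ *m _)); ring.
Qed.

Lemma word_germ w : isometry_germ (word_mx (reflections al) w) (dword_mx w).
Proof.
have [[v1 _ _] va1 _ _ _] := alE.
elim: w => [|i w IH] /=; last by apply: isometry_germM => //; apply: reflection_germ.
by move=> x y; rewrite !mul1mx !mul0mx lorentz0l lorentz0r addr0.
Qed.

Definition cosh_displacement w : R :=
  word_mx (reflections al) w (rshift n 0) (rshift n 0).

Lemma cosh_displacementE w :
  cosh_displacement w = - lorentz (word_mx (reflections al) w *m x0) x0.
Proof. by rewrite lorentz_basepointE opprK /basepoint -colE mxE. Qed.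

Lemma gram_expanding :
  exists2 K, 0 <= K & expanding_gram com (gram_entry al) dgram_entry eta K.
Proof.
have [[v1 v0 v2] va1 va0 va2 _] := alE.
have [K K0 HK] := fin_bounded (fun ij : S * S => (gram_entry al ij.1 ij.2)%:M : 'M[R]_1).
exists K => //; split=> [i|i j ij|i j ij nij|i j ij].
- by rewrite /gram_entry /dgram_entry v1 (lorentzC (al' i)) va1 addr0 mulr0 mulr1.
- by rewrite va0 // /gram_entry v0 // mulr0.
- by have [h1 _] := va2 i j ij nij; apply: le_trans h1; rewrite lerDl ltW.
- split; first by apply: le_trans (ler_norm _) _; have := HK (i, j) 0 0; rewrite mxE mulr1n.
  have [ij'|/va2[]//] := boolP (com i j).
  by rewrite va0 // /gram_entry v0 // !mulr0.
Qed.

Let y0 i : R := - lorentz x0 (al i).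
Let y0_gt0 i : 0 < y0 i.
Proof. by rewrite oppr_gt0; case: alE => _ _ _ _ /(_ i)[]. Qed.

Lemma cosh_displacement_ge1 w : reduced com w -> 1 <= cosh_displacement w.
Proof.
have [[v1 _ _] _ _ _ _] := alE; have [K K0 HK] := gram_expanding.
elim: w => [_|i w IH rw].
  by rewrite cosh_displacementE /= mul1mx lorentz_basepoint2 opprK.
have /andP[iD rw'] := rw; have [Hk _ _] :=
  height_sign com_sym com_irr (fun=> 0) HK (ltW eta_gt0) K0 y0_gt0 rw'.
have := Hk i iD; rewrite height_lorentz // => hi; have := IH rw'.
rewrite !cosh_displacementE /= -mulmxA reflection_mulE1 // !lorentzE.
rewrite !(lorentzC (al i)) => h.
have := mulr_ge0 (ltW (y0_gt0 i)) (ltW hi); rewrite /y0; lra.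
Qed.

(** The base point is a positive combination of the normals, so its displacement
    is at most a multiple of the largest height. *)
Lemma cosh_displacement_le w : reduced com w -> exists2 k, k \notin descents com w
  & cosh_displacement w <= (size ws).+1%:R / c * height (gram_entry al) y0 w k.
Proof.
move=> rw; have [K K0 HK] := gram_expanding; have F1 := cosh_displacement_ge1 rw.
have [[v1 _ _] _ _ _ _] := alE.
have F0 : 0 < cosh_displacement w by apply: lt_le_trans F1.
apply: contrapT => hex.
pose m := cosh_displacement w * c / (size ws).+1%:R.
have m0 : 0 < m by rewrite divr_gt0 // mulr_gt0.
have hm k : height (gram_entry al) y0 w k <= m.
  have [kD|kD] := boolP (k \in descents com w).
    have [_ Hj _] := height_sign com_sym com_irr (fun=> 0) HK (ltW eta_gt0) K0 y0_gt0 rw.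
    by apply: le_trans (ltW m0); rewrite -oppr_ge0 ltW // Hj.
  rewrite leNgt; apply/negP => hk; apply: hex; exists k => //.
  rewrite -ler_pdivrMl ?divr_gt0 // invf_div mulrC mulrA; exact: ltW.
have : c * cosh_displacement w <= \sum_(i <- ws) m.
  rewrite cosh_displacementE mulrN -lorentzZr -sum_al lorentz_sumr -sumrN.
  by apply: ler_sum => k _; rewrite -height_lorentz.
rewrite big_const_seq count_predT iter_addr_0 -mulr_natl leNgt => /negP; apply.
rewrite /m mulrCA [ltRHS]mulrC -[ltRHS]mulr1 (mulrC (cosh_displacement w)) -mulrA.
rewrite mulr1 gtr_pMr ?mulr_gt0 // ltr_pdivrMr // mul1r ltr_nat.
exact: ltnSn.
Qed.

(** If the affine action of [w] takes [X] to [X'], then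
    [X' g = g X + g'] with [g] the image of [w] and [g'] its derivative.  So
    [g'] is at most a multiple of [g] when [X] and [X'] are bounded, which
    holds for short words only. *)
Lemma affine_length_bound (c1 : R) : 0 <= c1 -> exists L : nat, forall w X X',
  reduced com w -> mx_bounded X c1 -> mx_bounded X' c1 ->
  X' *m word_mx (reflections al) w = word_mx (reflections al) w *m X + dword_mx w ->
  (size w <= L)%N.
Proof.
move=> c10; have [K K0 HK] := gram_expanding.
have [[v1 _ _] _ _ va2 va3] := alE.
have [ca ca0 Hca] := fin_bounded al; have [ca' ca'0 Hca'] := fin_bounded al'.
pose N : R := (n + 1)%:R; have N0 : 0 <= N by rewrite ler0n.
pose A := N * (N * ca).
pose D := N * (N * (N * c1 + N * c1) * ca) + N * (N * ca').
have A0 : 0 <= A by rewrite !mulr_ge0.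
have D0 : 0 <= D by rewrite !(addr_ge0, mulr_ge0).
have B0 : 0 < (size ws).+1%:R / c by rewrite divr_gt0.
have y0'_ge0 i : 0 <= - lorentz x0 (al' i) by rewrite oppr_ge0; case: (va3 i).
have Hb i j (ij : i != j) (nij : ~~ com i j) := (va2 i j ij nij).1.
have [L HL] := length_bound com_sym com_irr HK Hb eta_gt0 K0 b_gt0 y0_gt0 y0'_ge0
  A0 B0 D0.
exists L => w X X' rw HX HX' e; have F1 := cosh_displacement_ge1 rw.
set g := word_mx _ w in e *; pose F := cosh_displacement w.
have F0 : 0 <= F by apply: le_trans F1.
have Hg : mx_bounded g F.
  have gO : indef_orth n g by apply/indef_orthP => x y; case: (word_germ w x y).
  by have := indef_orth_bounded gO; rewrite -/(cosh_displacement w) ger0_norm.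
have Hgx : mx_bounded (g *m x0) F.
  by move=> i j; rewrite /basepoint -colE mxE.
have Hg'x : mx_bounded (dword_mx w *m x0) (N * (c1 * F) + N * (F * c1)).
  have -> : dword_mx w = X' *m g - g *m X by rewrite e addrAC subrr add0r.
  move=> i j; rewrite /basepoint -colE mxE.
  by apply: mx_boundedB; apply: mx_boundedM.
have [k kD Fk] := cosh_displacement_le rw.
apply: (HL w F k) => //.
  move=> j; rewrite height_lorentz // normrN; apply: le_trans (lorentz_bounded Hgx (Hca j)) _.
  by rewrite -/N le_eqVlt; apply/orP; left; apply/eqP; rewrite /A; ring.
rewrite dheight_lorentz opprD -/g.
have := lorentz_bounded Hg'x (Hca k); rewrite -normrN => /(le_trans (ler_norm _)) h1.
have := lorentz_bounded Hgx (Hca' k); rewrite -normrN => /(le_trans (ler_norm _)) h2.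
apply: le_trans (lerD h1 h2) _.
by rewrite -/N le_eqVlt; apply/orP; left; apply/eqP; rewrite /D; ring.
Qed.

Lemma finite_words (T : Type) (f : seq S -> T) L :
  finite_set [set g | exists2 w, (size w <= L)%N & g = f w].
Proof.
elim: L f => [|L IH] f.
  apply: (@sub_finite_set _ _ [set f [::]]); last exact: finite_set1.
  by move=> g [w]; rewrite leqn0 size_eq0 => /eqP-> ->.
apply: (@sub_finite_set _ _ ([set f [::]] `|`
    \bigcup_(i in [set: S]) [set g | exists2 w, (size w <= L)%N & g = f (i :: w)])).
  move=> g [[|i w] sw ->]; [by left|right].
  by exists i => //; exists w.
rewrite finite_setU; split; first exact: finite_set1.
by apply: bigcup_finite => [|i _]; [exact: finite_finset|exact: IH].
Qed.

(** The Coxeter group is given by any walls [v] for which it is faithful, possibly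
    in another dimension than the deformed representation; the representation and
    the cocycle [g' g^-1] are read off words. *)
Theorem proper_affine_action_of_deformation m (v : S -> 'cV[R]_(m + 1)) x
    (Gamma : set 'M[R]_(m + 1)) :
  coxeter_normals com v -> (forall i, lorentz x (v i) < 0) ->
  (forall g, Gamma g -> exists w, g = word_mx (reflections v) w) ->
  admits_proper_affine_action n Gamma.
Proof.
move=> vC xv HG; have [alC _ _ _ _] := alE.
have cal := reflections_coxeter alC; have cv := reflections_coxeter vC.
have cdal := dual_reflections_coxeter.
pose wd g := if pselect (exists w, g = word_mx (reflections v) w) is left h
  then projT1 (cid h) else [::].
pose spelled g := exists w, g = word_mx (reflections v) w.
have wdE g : spelled g -> g = word_mx (reflections v) (wd g).
  by rewrite /wd => sg; case: pselect => // h; case: (cid h).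
pose rho g := word_mx (reflections al) (wd g).
pose drho g := dword_mx (wd g).
have dE w : rho (word_mx (reflections v) w) = word_mx (reflections al) w /\
    drho (word_mx (reflections v) w) = dword_mx w.
  have sw : spelled (word_mx (reflections v) w) by exists w.
  have := word_mx_kernel com_sym com_irr vC xv cdal (esym (wdE _ sw)).
  by rewrite !word_dual_mx => /eq_block_mx[].
have dM g h : spelled g -> spelled h -> rho (g *m h) = rho g *m rho h /\
    drho (g *m h) = rho g *m drho h + drho g *m rho h.
  move=> sg sh; have e : g *m h = word_mx (reflections v) (wd g ++ wd h).
    by rewrite word_mx_cat -!wdE.
  have [] := dE (wd g ++ wd h); rewrite -e => -> ->.
  have := word_mx_cat dual_reflections (wd g) (wd h).
  by rewrite !word_dual_mx mul_dual_mx => /eq_block_mx[].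
have rho_unit g : rho g \in unitmx by apply: word_mx_unit cal.
pose u g := drho g *m invmx (rho g).
exists rho, u; split; [split|split|].
- by move=> g _; apply/indef_orthP => y z; case: (word_germ (wd g) y z).
- by move=> g h /HG sg /HG sh; case: (dM g h sg sh).
- by move=> g _; apply: germ_lie (rho_unit g); apply: word_germ.
- move=> g h /HG sg /HG sh; have [rM dM'] := dM g h sg sh.
  have inv_gh : invmx (rho g *m rho h) = invmx (rho h) *m invmx (rho g).
    rewrite -[RHS]mul1mx -(mulVmx (_ : rho g *m rho h \in unitmx)).
      by rewrite -!mulmxA (mulmxA (rho h)) mulmxV // mul1mx mulmxV // mulmx1.
    by rewrite unitmx_mul !rho_unit.
  rewrite /u /Ad rM dM' inv_gh mulmxDl addrC.
  by rewrite !mulmxA -(mulmxA (drho g)) mulmxV // mulmx1.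
- move=> C Cc _; have [c1 c10 HC] := compact_mx_bounded Cc.
  have [L HL] := affine_length_bound c10.
  apply: sub_finite_set (finite_words (word_mx (reflections v)) L).
  move=> g [/HG[w0 ->] [X' [[X CX <-] CX']]].
  have [w rw ew] := reduced_word com w0; exists w; last exact: ew.
  rewrite (ew _ _ _ cv) in CX'; have [rhoE drhoE] := dE w.
  apply: (HL w X (affine_action rho u (word_mx (reflections v) w) X)) => //.
  + exact: HC.
  + exact: HC.
  + rewrite /affine_action /Ad /u -rhoE -drhoE mulmxDl.
    by rewrite -!mulmxA mulVmx // !mulmx1.
Qed.

End Deformation.

(** * Deformations of coloured right-angled polytopes *)

Definition dot (R : realType) n (p q : 'cV[R]_n) : R := (p^T *m q) 0 0.

Section Dot.
Context {R : realType} {n : nat}.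
Implicit Types p q : 'cV[R]_n.

Lemma dotE p q : dot p q = \sum_i p i 0 * q i 0.
Proof. by rewrite /dot mxE; apply: eq_bigr => i _; rewrite mxE. Qed.

Lemma dotC p q : dot p q = dot q p.
Proof. by rewrite !dotE; apply: eq_bigr => i _; rewrite mulrC. Qed.

Lemma dotZr c p q : dot p (c *: q) = c * dot p q.
Proof. by rewrite /dot -scalemxAr mxE. Qed.

Lemma dotZl c p q : dot (c *: p) q = c * dot p q.
Proof. by rewrite dotC dotZr dotC. Qed.

Lemma dotDr p q r : dot p (q + r) = dot p q + dot p r.
Proof. by rewrite /dot mulmxDr mxE. Qed.

Lemma dotDl p q r : dot (q + r) p = dot q p + dot r p.
Proof. by rewrite dotC dotDr !(dotC p). Qed.

Lemma dot0r p : dot p 0 = 0.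
Proof. by rewrite /dot mulmx0 mxE. Qed.

Lemma lorentz_col p q (r s : R) :
  lorentz (col_mx p r%:M) (col_mx q s%:M) = dot p q - r * s.
Proof. by rewrite lorentz_col_mx; congr (_ - _); rewrite !mxE !mulr1n. Qed.

End Dot.

Lemma dot_col (R : realType) n m (p q : 'cV[R]_n) (p' q' : 'cV[R]_m) :
  dot (col_mx p p') (col_mx q q') = dot p q + dot p' q'.
Proof. by rewrite /dot tr_col_mx mul_row_col mxE. Qed.

Section Coloured.
Context {R : realType} {S : finType} (com : rel S) {d e : nat}.
Hypothesis com_sym : symmetric com.
Hypothesis com_irr : irreflexive com.
Variables (q : S -> 'cV[R]_d) (col : S -> 'cV[R]_e) (c0 kap delta : R) (ws : seq S).

(** Directions [q] of facets, such that adjacent facets make a constant angle and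
    the others are further apart, together with colours at the vertices of a regular
    simplex, distinct for adjacent facets. *)
Definition coloured_polytope : Prop :=
  [/\ forall i, dot (q i) (q i) = 1,
      forall i j, com i j -> dot (q i) (q j) = c0
    & forall i j, i != j -> ~~ com i j -> dot (q i) (q j) <= 2 * c0 - 1 - delta] /\
  [/\ forall i, dot (col i) (col i) = 1,
      forall i j, com i j -> dot (col i) (col j) = - kap
    & forall i j, dot (col i) (col j) = 1 \/ dot (col i) (col j) = - kap].

Hypothesis qcol : coloured_polytope.
Hypothesis kap_gt0 : 0 < kap.
Hypothesis delta_gt0 : 0 < delta.
Hypothesis delta_le : delta <= c0.
Hypothesis c0_lt1 : c0 < 1.
Hypothesis ws_neq0 : (0 < size ws)%N.
Hypothesis sum_q : \sum_(i <- ws) q i = 0.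
Hypothesis sum_col : \sum_(i <- ws) col i = 0.

(* The normals are (q_i, s col_i, r) / nu with r ^ 2 + kap s ^ 2 = c0, so that
   adjacent walls stay orthogonal.  As s varies, so does only the product
   of two normals of the same colour, besides the common norm nu.  The velocities
   s' and r' are those for which nu ^ 2 = 1 - c0 + (1 + kap) s ^ 2 decreases at
   speed 1; the value (1 + kap) s ^ 2 = delta / 4 keeps all other pairs of walls
   at a positive distance. *)
Let s := Num.sqrt (delta / 4 / (1 + kap)).
Let r := Num.sqrt (c0 - kap * (delta / 4 / (1 + kap))).
Let nu2 := 1 - c0 + delta / 4.
Let nu := Num.sqrt nu2.
Let s' := - (2 * (1 + kap) * s)^-1.
Let r' := kap / (2 * (1 + kap) * r).

Let vec i : 'cV[R]_((d + e) + 1) := col_mx (col_mx (q i) (s *: col i)) r%:M.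
Let vec' i : 'cV[R]_((d + e) + 1) := col_mx (col_mx 0 (s' *: col i)) r'%:M.

Definition coloured_normal i := nu^-1 *: vec i.
Definition dcoloured_normal i := nu^-1 *: (vec' i + (2 * nu2)^-1 *: vec i).

Let kap1 : 0 < 1 + kap. Proof. by rewrite addr_gt0. Qed.

Let s2 : s ^+ 2 = delta / 4 / (1 + kap).
Proof. by rewrite sqr_sqrtr // !divr_ge0 // ltW. Qed.

Let s_gt0 : 0 < s.
Proof. by rewrite sqrtr_gt0 !divr_gt0. Qed.

Let r2_gt0 : 0 < c0 - kap * (delta / 4 / (1 + kap)).
Proof.
rewrite subr_gt0 mulrA ltr_pdivrMr // mulrDr mulr1.
have h : kap * delta <= kap * c0 by rewrite ler_pM2l.
have c0p : 0 < c0 by apply: lt_le_trans delta_le.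
have := mulr_gt0 kap_gt0 c0p; lra.
Qed.

Let r2 : r ^+ 2 = c0 - kap * (delta / 4 / (1 + kap)).
Proof. by rewrite sqr_sqrtr // ltW. Qed.

Let r_gt0 : 0 < r.
Proof. by rewrite sqrtr_gt0. Qed.

Let nu2_gt0 : 0 < nu2.
Proof. by rewrite addr_gt0 ?subr_gt0 // divr_gt0. Qed.

Let nu_gt0 : 0 < nu.
Proof. by rewrite sqrtr_gt0. Qed.

Let nuE : nu ^+ 2 = nu2.
Proof. by rewrite sqr_sqrtr // ltW. Qed.

Let kapN0 : 1 + kap != 0. Proof. by rewrite gt_eqF. Qed.

Let lorentz_vec i j : lorentz (vec i) (vec j) = dot (q i) (q j) - c0 +
  delta / 4 / (1 + kap) * (kap + dot (col i) (col j)).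
Proof.
rewrite lorentz_col dot_col dotZl dotZr mulrA -!expr2 s2 r2; ring.
Qed.

Let lorentz_vec' i j : lorentz (vec i) (vec' j) =
  - (kap + dot (col i) (col j)) / (2 * (1 + kap)).
Proof.
rewrite lorentz_col dot_col dot0r dotZl dotZr /s' /r'; field.
by rewrite kapN0 (gt_eqF s_gt0) (gt_eqF r_gt0).
Qed.

Lemma coloured_expanding : expanding_normals com coloured_normal dcoloured_normal
  nu2^-1 (delta / nu2).
Proof.
case: qcol => [[q1 q0 q2] [e1 e0 e2]].
have nN : nu2 != 0 by rewrite gt_eqF.
have nuV : nu^-1 * nu^-1 = nu2^-1 by rewrite -invfM -expr2 nuE.
have B i j : lorentz (coloured_normal i) (coloured_normal j) =
    nu2^-1 * lorentz (vec i) (vec j).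
  by rewrite /coloured_normal !lorentzE mulrA nuV.
have B' i j : lorentz (coloured_normal i) (dcoloured_normal j) =
    nu2^-1 * (lorentz (vec i) (vec' j) + (2 * nu2)^-1 * lorentz (vec i) (vec j)).
  by rewrite /coloured_normal /dcoloured_normal !lorentzE mulrA nuV.
have dB i j : lorentz (dcoloured_normal i) (coloured_normal j) =
    lorentz (coloured_normal i) (dcoloured_normal j).
  by rewrite lorentzC !B' !lorentz_vec' !lorentz_vec (dotC (q j)) (dotC (col j)).
have G i j : gram_entry coloured_normal i j = - 2 * (nu2^-1 * lorentz (vec i) (vec j)).
  by rewrite /gram_entry B.
have dG i j : dgram_entry coloured_normal dcoloured_normal i j =
    - 2 * (2 * (nu2^-1 * lorentz (vec i) (vec' j)) + nu2^-1 * (nu2^-1 * lorentz (vec i) (vec j))).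
  by rewrite /dgram_entry dB B'; field.
have com0 i j : com i j -> lorentz (vec i) (vec j) = 0 /\ lorentz (vec i) (vec' j) = 0.
  move=> ij; rewrite lorentz_vec lorentz_vec' q0 // e0 //.
  by rewrite !subrr mulr0 addr0 oppr0 mul0r.
have vec_ii i : lorentz (vec i) (vec i) = nu2.
  by rewrite lorentz_vec q1 e1 /nu2; field.
have e_le i j : 0 <= kap + dot (col i) (col j) <= 1 + kap.
  by case: (e2 i j) => ->; have := kap_gt0; lra.
have vec_le i j : i != j -> ~~ com i j -> lorentz (vec i) (vec j) <= - nu2 - delta / 2.
  move=> ij nij; rewrite lorentz_vec.
  have /andP[_ h] := e_le i j.
  have : delta / 4 / (1 + kap) * (kap + dot (col i) (col j)) <= delta / 4.
    by rewrite -[leRHS](divfK kapN0) ler_pM2l // !divr_gt0.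
  have := q2 i j ij nij; rewrite /nu2; lra.
split.
- split=> [i|i j ij|i j ij nij].
  + by rewrite B vec_ii mulVf.
  + by rewrite B (com0 i j ij).1 mulr0.
  + rewrite B mulrC ler_pdivrMr // mulN1r; apply: le_trans (vec_le i j ij nij) _.
    by have := delta_gt0; lra.
- move=> i; rewrite B' lorentz_vec' vec_ii e1; field.
  by rewrite kapN0 nN.
- by move=> i j ij; rewrite dG (com0 i j ij).1 (com0 i j ij).2 !mulr0 addr0 mulr0.
- move=> i j ij nij; have h := vec_le i j ij nij; rewrite dG G.
  split.
    rewrite (_ : 2 + delta / nu2 = nu2^-1 * (2 * nu2 + delta)); last by field.
    rewrite mulrCA ler_pM2l ?invr_gt0 //; lra.
  rewrite mulrCA -subr_ge0.
  rewrite (_ : _ - _ = 4 * nu2^-1 * - lorentz (vec i) (vec' j)); last by ring.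
  rewrite lorentz_vec' mulNr opprK; have /andP[h0 _] := e_le i j.
  by rewrite !mulr_ge0 // ?invr_ge0 ?mulr_ge0 // ltW.
- have lv i : lorentz basepoint (vec i) = - r.
    by rewrite lorentzC lorentz_basepointE col_mxEd mxE eqxx mulr1n.
  have lv' i : lorentz basepoint (vec' i) = - r'.
    by rewrite lorentzC lorentz_basepointE col_mxEd mxE eqxx mulr1n.
  move=> i; rewrite /coloured_normal /dcoloured_normal !lorentzE lv lv' !mulrN.
  rewrite oppr_lt0 -opprD mulrN oppr_le0; split; first by rewrite mulr_gt0 // invr_gt0.
  by rewrite /r' !(mulr_ge0, addr_ge0) // ?invr_ge0 ?mulr_ge0 // ltW.
Qed.

Lemma sum_coloured_normal :
  \sum_(i <- ws) coloured_normal i = ((size ws)%:R * r / nu) *: basepoint.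
Proof.
have sumE (w : seq S) : \sum_(i <- w) vec i =
    col_mx (col_mx (\sum_(i <- w) q i) (s *: \sum_(i <- w) col i)) ((size w)%:R * r)%:M.
  elim: w => [|i w IH] /=.
    by rewrite !big_nil scaler0 mul0r !raddf0 !col_mx0.
  rewrite !big_cons IH /vec !add_col_mx -scalerDr -natr1; congr col_mx.
  by apply/matrixP => k l; rewrite !ord1 !mxE eqxx !mulr1n; ring.
rewrite /coloured_normal -scaler_sumr sumE sum_q sum_col scaler0 col_mx0 basepointE.
rewrite !scale_col_mx !scaler0; congr col_mx.
by apply/matrixP => i j; rewrite !mxE !ord1 !eqxx !mulr1n mulr1 mulrC.
Qed.

Theorem coloured_proper_affine_action m (v : S -> 'cV[R]_(m + 1)) x
    (Gamma : set 'M[R]_(m + 1)) :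
  coxeter_normals com v -> (forall i, lorentz x (v i) < 0) ->
  (forall g, Gamma g -> exists w, g = word_mx (reflections v) w) ->
  admits_proper_affine_action (d + e) Gamma.
Proof.
apply: (proper_affine_action_of_deformation com_sym com_irr coloured_expanding _ _ _
  sum_coloured_normal).
- by rewrite invr_gt0.
- by rewrite divr_gt0.
- by rewrite divr_gt0 // mulr_gt0 // ltr0n.
Qed.

End Coloured.

(** * The 600-cell over the golden integers *)

(** The pair (a, b) stands for a + b phi, where phi is the golden ratio. *)
Local Notation golden_int := (int * int)%type.

Section Cell600.
Implicit Types (z t : golden_int) (x y : seq golden_int).

Definition gi_opp z : golden_int := (- z.1, - z.2).
Definition gi_add z t : golden_int := (z.1 + t.1, z.2 + t.2).
Definition gi_mul z t : golden_int :=
  (z.1 * t.1 + z.2 * t.2, z.1 * t.2 + z.2 * t.1 + z.2 * t.2).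

Definition gi_nth x i := nth (0, 0) x i.

Definition gi_dot x y :=
  gi_add (gi_add (gi_mul (gi_nth x 0) (gi_nth y 0)) (gi_mul (gi_nth x 1) (gi_nth y 1)))
         (gi_add (gi_mul (gi_nth x 2) (gi_nth y 2)) (gi_mul (gi_nth x 3) (gi_nth y 3))).

(** An arrangement p lists the values of a permutation; evenness is read off the
    number of inversions. *)
Definition even_arrangements : seq (seq nat) :=
  [seq p <- permutations (iota 0 4) |
     ~~ odd (sumn [seq count (fun j => nth 0 p i < nth 0 p j)%N (iota 0 i) | i <- iota 0 4])].

(** Twice the absolute values of the coordinates of the vertices. *)
Definition abs_vertices : seq (seq golden_int) :=
  [seq [seq (if j == i then (2%:Z, 0) else (0, 0)) | j <- iota 0 4] | i <- iota 0 4]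
  ++ [:: nseq 4 (1%:Z, 0)]
  ++ [seq [seq gi_nth [:: (0, 1%:Z); (1%:Z, 0); (-1%:Z, 1%:Z); (0, 0)] (index i p) | i <- iota 0 4]
     | p <- even_arrangements].

Fixpoint sign_choices x : seq (seq golden_int) :=
  if x is z :: x' then
    [seq t :: y | t <- [:: z; gi_opp z], y <- sign_choices x'] else [:: [::]].

Definition cell600 : seq (seq golden_int) :=
  undup (flatten [seq sign_choices x | x <- abs_vertices]).

(** Twice the powers 1, g, g^2, g^3, g^4 of the quaternion
    g = (phi + i + phi^-1 j) / 2 of order 10, which represent the five cosets of the
    binary tetrahedral group in the binary icosahedral group. *)
Definition coset_reps : seq (seq golden_int) :=
  [:: [:: (2%:Z, 0); (0, 0); (0, 0); (0, 0)];
      [:: (0, 1%:Z); (1%:Z, 0); (-1%:Z, 1%:Z); (0, 0)];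
      [:: (-1%:Z, 1%:Z); (0, 1%:Z); (1%:Z, 0); (0, 0)];
      [:: (1%:Z, -1%:Z); (0, 1%:Z); (1%:Z, 0); (0, 0)];
      [:: (0, -1%:Z); (1%:Z, 0); (-1%:Z, 1%:Z); (0, 0)]].

(** The product of the conjugate of the quaternion [x] with [y]. *)
Definition conj_mul x y : seq golden_int :=
  let a := gi_nth x 0 in let b := gi_nth x 1 in
  let c := gi_nth x 2 in let d := gi_nth x 3 in
  let e := gi_nth y 0 in let f := gi_nth y 1 in
  let g := gi_nth y 2 in let h := gi_nth y 3 in
  let s := foldr gi_add (0, 0) in let n z t := gi_opp (gi_mul z t) in
  [:: s [:: gi_mul a e; gi_mul b f; gi_mul c g; gi_mul d h];
      s [:: gi_mul a f; n b e; n c h; gi_mul d g];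
      s [:: gi_mul a g; gi_mul b h; n c e; n d f];
      s [:: gi_mul a h; n b g; gi_mul c f; n d e]].

(** As unit quaternions the vertices of the 600-cell form the binary icosahedral
    group; the elements of the binary tetrahedral subgroup are those whose
    coordinates do not involve the golden ratio.  The colour is the coset. *)
Definition colour x : nat :=
  find (fun r => all (fun z => z.2 == 0) (conj_mul r x)) coset_reps.

(** With doubled coordinates, this is the inner product [phi / 2] of the directions
    of adjacent facets. *)
Definition neighbours x y : bool := gi_dot x y == (0, 2%:Z).

(** Four times the inner products of distinct non-adjacent directions; none of these
    products exceeds 1/2, so that non-adjacent facets of the right-angled 120-cell do not meet. *)
Definition small_dots : seq golden_int :=
  [:: (2%:Z, 0); (-2%:Z, 2%:Z); (0, 0); (2%:Z, -2%:Z); (-2%:Z, 0); (0, -2%:Z); (-4%:Z, 0)].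

(** Distinct vertices of one colour differ by an element of the binary
    tetrahedral group, whose real part is never [phi / 2]. *)
Lemma cell600_table : all (fun x => all (fun y =>
  (gi_dot x y == gi_dot y x) &&
  (if x == y then gi_dot x y == (4%:Z, 0) else
   if neighbours x y then colour x != colour y else gi_dot x y \in small_dots)) cell600)
  cell600.
Proof. by vm_compute. Qed.

Lemma colour_lt5 : all (fun x => colour x < 5)%N cell600.
Proof. by vm_compute. Qed.


Section RealCell.
Context {R : realType}.
Local Notation phi := (@golden R).

Lemma golden_sqr : phi ^+ 2 = phi + 1.
Proof.
rewrite /golden; set t := Num.sqrt 5; have t2 : t ^+ 2 = 5 by rewrite sqr_sqrtr.
rewrite [LHS](_ : _ = (1 + 2 * t + t ^+ 2) / 4); last by field.
by rewrite t2; field.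
Qed.

Lemma golden_bounds : 3 / 2 < phi < 2.
Proof.
rewrite /golden; set t := Num.sqrt 5; have t2 : t ^+ 2 = 5 by rewrite sqr_sqrtr.
have t0 : 0 <= t by rewrite sqrtr_ge0.
have h2 : 2 < t.
  by rewrite ltNge; apply/negP => h; have := ler_pM t0 t0 h h; rewrite -expr2 t2; lra.
have h3 : t < 3.
  have n3 : 0 <= 3 :> R by [].
  by rewrite ltNge; apply/negP => h; have := ler_pM n3 n3 h h; rewrite -(expr2 t) t2; lra.
by apply/andP; split; lra.
Qed.

Lemma golden_gt0 : 0 < phi.
Proof. by have := golden_bounds; lra. Qed.

Lemma goldenV : phi^-1 = phi - 1.
Proof.
have p0 : phi != 0 by rewrite gt_eqF // golden_gt0.
by apply: (mulfI p0); rewrite divff // mulrBr mulr1 -expr2 golden_sqr; ring.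
Qed.

Definition gi_val z : R := z.1%:~R + z.2%:~R * phi.

Lemma gi_val_opp z : gi_val (gi_opp z) = - gi_val z.
Proof. by rewrite /gi_val /= !rmorphN /=; ring. Qed.

Lemma gi_val_add z t : gi_val (gi_add z t) = gi_val z + gi_val t.
Proof. by rewrite /gi_val /= !rmorphD /=; ring. Qed.

Lemma gi_val_mul z t : gi_val (gi_mul z t) = gi_val z * gi_val t.
Proof.
rewrite /gi_val /= !(rmorphD, rmorphM) /=.
rewrite [RHS](_ : _ = z.1%:~R * t.1%:~R + (z.1%:~R * t.2%:~R + z.2%:~R * t.1%:~R) * phi
  + z.2%:~R * t.2%:~R * phi ^+ 2); last by ring.
by rewrite golden_sqr; ring.
Qed.

Definition vertex x : 'cV[R]_4 := \col_i (gi_val (gi_nth x i) / 2).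

Lemma dot_vertex x y : dot (vertex x) (vertex y) = gi_val (gi_dot x y) / 4.
Proof.
rewrite dotE !big_ord_recl big_ord0 !mxE /= /gi_dot !(gi_val_add, gi_val_mul).
by rewrite addr0; field.
Qed.

Lemma mem_sign_choices x y : size y = size x ->
  (forall i, (i < size x)%N -> gi_nth y i = gi_nth x i \/ gi_nth y i = gi_opp (gi_nth x i)) ->
  y \in sign_choices x.
Proof.
elim: x y => [|z x IH] [|t y] // [sxy] H.
have h0 := H 0%N isT; have hS i (ix : (i < size x)%N) := H i.+1 ix.
have yin := IH y sxy hS; apply/allpairsP; exists (t, y); split=> //=.
by case: h0 => /= ->; rewrite !inE eqxx ?orbT.
Qed.

Lemma vertex_abs (q : 'cV[R]_4) x : x \in abs_vertices ->
  (forall i : 'I_4, `|q i 0| = gi_val (gi_nth x i) / 2) ->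
  exists2 y, y \in cell600 & q = vertex y.
Proof.
move=> xin H; have sx : size x = 4.
  by apply/eqP; move: xin; apply: (allP (_ : all (fun x => size x == 4) _)).
pose y := [seq (if 0 <= q (inord i) 0 then gi_nth x i else gi_opp (gi_nth x i)) | i <- iota 0 4].
have yE (i : 'I_4) : gi_nth y i =
    if 0 <= q i 0 then gi_nth x i else gi_opp (gi_nth x i).
  by rewrite /y /gi_nth (nth_map 0%N) ?size_iota // nth_iota // add0n inord_val.
exists y.
  rewrite mem_undup; apply/flattenP; exists (sign_choices x); first exact: map_f.
  apply: mem_sign_choices; rewrite sx // => i i4.
  by rewrite (yE (Ordinal i4)); case: ifP; [left|right].
apply/matrixP => i j; rewrite ord1 !mxE yE; case: ifPn => h.
  by rewrite -H ger0_norm.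
rewrite gi_val_opp mulNr -H ltr0_norm ?opprK // ltNge; exact: h.
Qed.

(** Each permutation of four points is a product of three transpositions or
    identities which successively fix 0, 1, 2; the parity is then explicit in
    each of the 24 cases. *)
Lemma perm4_even (s : 'S_4) : ~~ odd_perm s ->
  [seq val (s (inord k)) | k <- iota 0 4] \in even_arrangements.
Proof.
pose o0 : 'I_4 := Ordinal (isT : 0 < 4)%N; pose o1 : 'I_4 := Ordinal (isT : 1 < 4)%N.
pose o2 : 'I_4 := Ordinal (isT : 2 < 4)%N; pose o3 : 'I_4 := Ordinal (isT : 3 < 4)%N.
have -> : [seq val (s (inord k)) | k <- iota 0 4] =
    [:: val (s o0); val (s o1); val (s o2); val (s o3)].
  have io k (k4 : (k < 4)%N) : inord k = Ordinal k4 :> 'I_4.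
    by apply: val_inj; rewrite /= inordK.
  by rewrite /= (io 0%N isT) (io 1%N isT) (io 2%N isT) (io 3%N isT).
have [a [b [c [b0 c0 c1 ->]]]] : exists a b c : 'I_4, [/\ b != o0, c != o0, c != o1
    & s = (tperm o2 c * tperm o1 b * tperm o0 a)%g].
  pose t1 := (s * tperm o0 (s o0))%g; pose t2 := (t1 * tperm o1 (t1 o1))%g.
  pose t3 := (t2 * tperm o2 (t2 o2))%g.
  have t10 : t1 o0 = o0 by rewrite permM tpermR.
  have t1b : t1 o1 != o0 by rewrite -t10 (inj_eq perm_inj).
  have t20 : t2 o0 = o0 by rewrite permM t10 tpermD // eq_sym.
  have t21 : t2 o1 = o1 by rewrite permM tpermR.
  have t2c0 : t2 o2 != o0 by rewrite -t20 (inj_eq perm_inj).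
  have t2c1 : t2 o2 != o1 by rewrite -t21 (inj_eq perm_inj).
  have t30 : t3 o0 = o0 by rewrite permM t20 tpermD // eq_sym.
  have t31 : t3 o1 = o1 by rewrite permM t21 tpermD // eq_sym.
  have t32 : t3 o2 = o2 by rewrite permM tpermR.
  have t3E : t3 = 1%g.
    apply/permP => i; rewrite perm1.
    have t33 : t3 o3 = o3.
      have n0 : t3 o3 != o0 by rewrite -t30 (inj_eq perm_inj).
      have n1 : t3 o3 != o1 by rewrite -t31 (inj_eq perm_inj).
      have n2 : t3 o3 != o2 by rewrite -t32 (inj_eq perm_inj).
      by move: (t3 o3) n0 n1 n2 => -[[|[|[|[|//]]]] h] // _ _ _; apply: val_inj.
    case: i => -[|[|[|[|//]]]] h.
    - by rewrite (_ : Ordinal h = o0) //; apply: val_inj.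
    - by rewrite (_ : Ordinal h = o1) //; apply: val_inj.
    - by rewrite (_ : Ordinal h = o2) //; apply: val_inj.
    - by rewrite (_ : Ordinal h = o3) //; apply: val_inj.
  exists (s o0), (t1 o1), (t2 o2); split=> //.
  have e1 : s = (t1 * tperm o0 (s o0))%g by rewrite /t1 -mulgA tperm2 mulg1.
  have e2 : t1 = (t2 * tperm o1 (t1 o1))%g by rewrite {1}/t2 -mulgA tperm2 mulg1.
  have e3 : t2 = tperm o2 (t2 o2) by rewrite -[LHS]mulg1 -(tperm2 o2 (t2 o2)) mulgA -/t3 t3E mul1g.
  by rewrite {1}e1 {1}e2 {1}e3.
rewrite !odd_permM !odd_tperm !permM.
case: a b c b0 c0 c1 => -[|[|[|[|//]]]] ha [[|[|[|[|//]]]] hb] // [[|[|[|[|//]]]] hc] // _ _ _.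
all: rewrite !permE //= => _; vm_compute.
all: reflexivity.
Qed.

Lemma vertices_600cell_vertex (q : 'cV[R]_4) : vertices_600cell q ->
  exists2 x, x \in cell600 & q = vertex x.
Proof.
have p0 := golden_gt0; have iv k (k4 : (k < 4)%N) : nat_of_ord (inord k : 'I_4) = k.
  by rewrite inordK.
have val2 : gi_val (2%:Z, 0) = 2 by rewrite /gi_val /= mul0r addr0.
have val0 : gi_val (0, 0) = 0 by rewrite /gi_val /= mul0r addr0.
have val1 : gi_val (1%:Z, 0) = 1 by rewrite /gi_val /= mul0r addr0.
case=> [[i [qi qj]]|qh|[s [se q0 q1 q2 q3]]].
- apply: (@vertex_abs q [seq (if j == val i then (2%:Z, 0) else (0, 0)) | j <- iota 0 4]).
    rewrite mem_cat; apply/orP; left; apply/mapP; exists (val i) => //.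
    by rewrite mem_iota /=.
  move=> j; rewrite /gi_nth (nth_map 0%N) ?size_iota // nth_iota // add0n.
  case: ifPn => [/eqP/val_inj->|ji]; first by rewrite qi val2 divff.
  by rewrite qj ?normr0 ?val0 ?mul0r //.
- apply: (@vertex_abs q (nseq 4 (1%:Z, 0))).
    by rewrite !mem_cat; apply/orP; right; apply/orP; left; apply: mem_head.
  by move=> i; rewrite qh /gi_nth nth_nseq ltn_ord val1 mul1r.
- pose p := [seq val (s (inord k)) | k <- iota 0 4].
  apply: (@vertex_abs q [seq gi_nth [:: (0, 1%:Z); (1%:Z, 0); (-1%:Z, 1%:Z); (0, 0)]
      (index i p) | i <- iota 0 4]).
    rewrite !mem_cat; apply/orP; right; apply/orP; right.
    by apply/mapP; exists p => //; apply: perm4_even.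
  move=> i; rewrite {1}/gi_nth (nth_map 0%N) ?size_iota // nth_iota // add0n.
  have [k ->] : exists k, i = s k by exists ((s^-1)%g i); rewrite permKV.
  have -> : index (val (s k)) p = k.
    have up : uniq p.
      rewrite map_inj_in_uniq ?iota_uniq // => a b.
      rewrite !mem_iota /= add0n => a4 b4 /val_inj/perm_inj/(congr1 val).
      by rewrite /= !inordK.
    rewrite -[RHS](index_uniq 0%N _ up) ?size_map ?size_iota //; congr index.
    by rewrite (nth_map 0%N) ?size_iota // nth_iota // add0n inord_val.
  rewrite (_ : k = inord k); last by rewrite inord_val.
  case: k => -[|[|[|[|//]]]] h /=; rewrite iv //= /gi_nth /=.
  + by rewrite q0 /gi_val /= mul1r add0r.
  + by rewrite q1 val1 mul1r.
  + by rewrite q2 goldenV /gi_val /= mul1r addrC.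
  + by rewrite q3 normr0 val0 mul0r.
Qed.

Lemma gi_dotC x y : x \in cell600 -> y \in cell600 -> gi_dot x y = gi_dot y x.
Proof. by move=> xc yc; have /andP[/eqP] := allP (allP cell600_table x xc) y yc. Qed.

Lemma dot_vertex_diag x : x \in cell600 -> dot (vertex x) (vertex x) = 1.
Proof.
move=> xc; have /andP[_] := allP (allP cell600_table x xc) x xc.
rewrite eqxx => /eqP e; rewrite dot_vertex e.
have -> : gi_val (4%:Z, 0) = 4 by rewrite /gi_val /= mul0r addr0.
by rewrite divff.
Qed.

Lemma dot_vertex_adjacent x y : neighbours x y -> dot (vertex x) (vertex y) = phi / 2.
Proof. by move=> /eqP e; rewrite dot_vertex e /gi_val /= add0r; field. Qed.

Lemma dot_vertex_far x y : x \in cell600 -> y \in cell600 -> x != y ->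
  ~~ neighbours x y -> dot (vertex x) (vertex y) <= 1 / 2.
Proof.
move=> xc yc xy nxy; have /andP[_] := allP (allP cell600_table x xc) y yc.
rewrite (negbTE xy) (negbTE nxy) dot_vertex => h.
have {h} : gi_val (gi_dot x y) <= 2.
  have /andP[p1 p2] := golden_bounds.
  move: h; rewrite !inE => /or3P[/eqP->|/eqP->|].
  - by rewrite /gi_val /=; lra.
  - by rewrite /gi_val /=; lra.
  by do 4?[case/orP => [/eqP->|]] => [||||/eqP->]; rewrite /gi_val /=; lra.
by lra.
Qed.

Lemma dot_vertex_le x y : x \in cell600 -> y \in cell600 -> x != y ->
  dot (vertex x) (vertex y) <= phi / 2.
Proof.
move=> xc yc xy; have [/dot_vertex_adjacent->//|nxy] := boolP (neighbours x y).
by apply: le_trans (dot_vertex_far xc yc xy nxy) _; have := golden_bounds; lra.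
Qed.

Let x1 := nth [::] coset_reps 0.
Let x2 := nth [::] coset_reps 1.

Lemma vertices_600cell_x1 : vertices_600cell (vertex x1).
Proof.
have v0 : gi_val (0, 0) / 2 = 0 by rewrite /gi_val /= !mul0r addr0 mul0r.
have v1 : gi_val (2%:Z, 0) / 2 = 1.
  rewrite (_ : gi_val _ = 2); last by rewrite /gi_val /= mul0r addr0.
  by rewrite divff.
apply: Or31; exists ord0; rewrite mxE v1 normr1; split=> // j.
by case: j => -[|[|[|[|//]]]] h // _; rewrite mxE v0.
Qed.

Lemma vertices_600cell_x2 : vertices_600cell (vertex x2).
Proof.
have p0 := golden_gt0; have /andP[p1 _] := golden_bounds.
apply: Or33; exists 1%g; rewrite odd_perm1 !perm1 !mxE !inordK // /gi_val /=; split=> //.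
- by rewrite mul1r add0r gtr0_norm // divr_gt0.
- by rewrite mul0r addr0 mul1r gtr0_norm.
- by rewrite mul1r goldenV (_ : -1 + phi = phi - 1) ?gtr0_norm ?divr_gt0 //; [lra|ring].
- by rewrite mul0r addr0 mul0r.
Qed.

Lemma adjacent_vertices : exists q1 q2 : 'cV[R]_4,
  [/\ vertices_600cell q1 /\ vertices_600cell q2, q1 <> q2,
    dot q1 q1 = 1 /\ dot q2 q2 = 1, dot q1 q2 = phi / 2
    & forall q, vertices_600cell q -> q <> q1 -> q <> q2 -> dot q q1 + dot q q2 <= phi].
Proof.
have c1 : x1 \in cell600 by vm_compute.
have c2 : x2 \in cell600 by vm_compute.
have d12 : dot (vertex x1) (vertex x2) = phi / 2.
  by apply: dot_vertex_adjacent; vm_compute.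
have d1 := dot_vertex_diag c1.
exists (vertex x1), (vertex x2); split.
- by split; [exact: vertices_600cell_x1|exact: vertices_600cell_x2].
- by move=> e; move: d12; rewrite -e d1; have := golden_bounds; lra.
- by split; [exact: d1|exact: dot_vertex_diag].
- exact: d12.
move=> q /vertices_600cell_vertex[x xc ->] n1 n2.
have xn1 : x != x1 by apply: contra_not_neq n1 => ->.
have xn2 : x != x2 by apply: contra_not_neq n2 => ->.
by have := lerD (dot_vertex_le xc c1 xn1) (dot_vertex_le xc c2 xn2); lra.
Qed.

End RealCell.

End Cell600.

(** * The right-angled 120-cell *)

Section SimplexColours.
Context {R : realType}.
Local Notation t := (Num.sqrt 5 : R).

(** Four times the vertices of a regular simplex inscribed in the unit sphere. *)
Definition simplex_coords : seq (seq R) :=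
  [:: [:: t; t; t; -1]; [:: t; - t; - t; -1]; [:: - t; t; - t; -1];
      [:: - t; - t; t; -1]; [:: 0; 0; 0; 4]].

Definition simplex (c : nat) : 'cV[R]_4 :=
  \col_i (nth 0 (nth [::] simplex_coords c) i / 4).

Lemma dot_simplex c c' : (c < 5)%N -> (c' < 5)%N ->
  dot (simplex c) (simplex c') = if c == c' then 1 else - (1 / 4).
Proof.
have t2 : t ^+ 2 = 5 by rewrite sqr_sqrtr.
have tE : t * t = 5 by rewrite -expr2.
move: c c' => [|[|[|[|[|//]]]]] [|[|[|[|[|//]]]]] _ _;
  rewrite dotE !big_ord_recl big_ord0 !mxE /=; move: (t) tE => s sE; lra.
Qed.

Lemma sum_simplex : \sum_(c <- iota 0 5) simplex c = 0.
Proof.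
apply/matrixP => i j; rewrite /= !big_cons big_nil !mxE.
by case: i => -[|[|[|[|//]]]] h /=; lra.
Qed.

End SimplexColours.

Section Cell120.
Context {R : realType}.
Local Notation phi := (@golden R).
Implicit Types (N : set 'cV[R]_(4 + 1)).

Let S := seq_sub cell600.
Let com (i j : S) : bool := neighbours (val i) (val j).
Let vtx (i : S) : 'cV[R]_4 := vertex (val i).
Let colr (i : S) : 'cV[R]_4 := simplex (colour (val i)).

Let com_sym : symmetric com.
Proof. by move=> i j; rewrite /com /neighbours gi_dotC //; apply: valP. Qed.

Let com_irr : irreflexive com.
Proof.
move=> i; apply/negP => /(@dot_vertex_adjacent R).
by rewrite dot_vertex_diag ?(valP i) //; have := @golden_bounds R; lra.
Qed.

Lemma coloured_cell120 : coloured_polytope com vtx colr (phi / 2) (1 / 4) (phi - 3 / 2).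
Proof.
have c5 (i : S) : (colour (val i) < 5)%N by apply: (allP colour_lt5); apply: valP.
split; split.
- by move=> i; apply: dot_vertex_diag; apply: valP.
- by move=> i j; apply: dot_vertex_adjacent.
- move=> i j ij nij; have := @dot_vertex_far R _ _ (valP i) (valP j) ij nij.
  by rewrite /vtx; lra.
- by move=> i; rewrite dot_simplex // eqxx.
- move=> i j ij; rewrite dot_simplex //.
  have /andP[_] := allP (allP cell600_table _ (valP i)) _ (valP j).
  have ij' : val i != val j by apply: contraTneq ij => /val_inj->; rewrite com_irr.
  by rewrite (negbTE ij') -[neighbours _ _]/(com i j) ij => /negbTE->.
- by move=> i j; rewrite dot_simplex //; case: ifP; [left|right].
Qed.

(** The midpoint of two adjacent facets is the point to look at: by compactness it
    lies inside the ball, hence on a genuine codimension-two face, and the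
    right angle there determines the inradius. *)
Lemma right_angled_120cell_radius N : compact_right_angled_120cell N ->
  exists g r, [/\ hyp_isometry g, 0 < r, r ^+ 2 = phi / 2
    & N = [set g *m col_mx q r%:M | q in vertices_600cell]].
Proof.
move=> [[g [r [gH /andP[r0 r1] NE]]] Ncompact Nright]; exists g, r; split=> //.
have [gO gpos] := gH; have /indef_orthP gP := gO.
have /andP[p1 p2] := @golden_bounds R.
have [q1 [q2 [[V1 V2] q12 [d1 d2] d12 dle]]] := @adjacent_vertices R.
pose m := q1 + q2; pose k := 1 + phi / 2.
have k0 : 0 < k by rewrite /k; lra.
have mm : dot m m = 2 * k.
  by rewrite /m !(dotDl, dotDr) d1 d2 (dotC q2) d12 /k; field.
have q1m : dot q1 m = k by rewrite /m dotDr d1 d12.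
have q2m : dot q2 m = k by rewrite /m dotDr d2 dotC d12 /k addrC.
have qm q : vertices_600cell q -> dot q m <= k.
  move=> Vq; have [->|/eqP n1] := eqVneq q q1; first by rewrite q1m.
  have [->|/eqP n2] := eqVneq q q2; first by rewrite q2m.
  by rewrite /m dotDr; have := dle q Vq n1 n2; rewrite /k; lra.
(* The point of hyperbolic space at s m in the projective model, on the ray from
   the centre to the common midpoint of the two chosen facets. *)
pose ray s : 'cV[R]_(4 + 1) :=
  (Num.sqrt (1 - s ^+ 2 * (2 * k)))^-1 *: col_mx (s *: m) 1%:M.
have lray s (q : 'cV[R]_4) : lorentz (col_mx q r%:M) (ray s) =
    (Num.sqrt (1 - s ^+ 2 * (2 * k)))^-1 * (s * dot q m - r).
  by rewrite lorentzZr lorentz_col dotZr mulr1.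
have ray_hyp s : s ^+ 2 * (2 * k) < 1 -> hyperboloid (ray s).
  move=> s1; have pos : 0 < 1 - s ^+ 2 * (2 * k) by rewrite subr_gt0.
  split.
    rewrite !lorentzE lorentz_col dotZl dotZr mm mulrA -invfM -expr2 sqr_sqrtr ?ltW //.
    by field; rewrite gt_eqF.
  by rewrite linearZ /= col_mxKd !mxE mulr1 invr_gt0 sqrtr_gt0.
have ray_poly s : 0 <= s -> s * k <= r -> s ^+ 2 * (2 * k) < 1 -> polytope N (g *m ray s).
  move=> s0 sr s1; split; first exact/gpos/ray_hyp.
  move=> v; rewrite NE => -[q Vq <-]; rewrite gP lray mulr_ge0_le0 ?invr_ge0 ?sqrtr_ge0 //.
  rewrite subr_le0; apply: le_trans sr; exact: ler_wpM2l (qm q Vq).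
pose s0 := r / k.
have s0k : s0 * k = r by rewrite divfK // gt_eqF.
have s00 : 0 <= s0 by rewrite divr_ge0 // ltW.
(* If the midpoint is not inside the ball, then the ray towards it stays in the
   polytope up to infinity. *)
have [in_ball|out_ball] := ltP (s0 ^+ 2 * (2 * k)) 1; last first.
  have [c c_ge0 Hc] := compact_mx_bounded Ncompact.
  have [a a_ge0 Ha] := fin_bounded (fun _ : unit => g *m (basepoint : 'cV[R]_(4 + 1))).
  pose M := (4 + 1)%:R * ((4 + 1)%:R * (a * 1) * c).
  have M0 : 0 <= M by rewrite !mulr_ge0.
  have M1 : 0 < M + 1 by rewrite ltr_wpDl.
  pose e := (M + 1)^-1 ^+ 2; have e0 : 0 < e by rewrite exprn_gt0 // invr_gt0.
  have e1 : e <= 1.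
    by apply: exprn_ile1; [rewrite invr_ge0 ltW|rewrite invf_le1 // lerDr].
  pose s := Num.sqrt ((1 - e) / (2 * k)).
  have k2 : 0 < 2 * k by rewrite mulr_gt0.
  have s2 : s ^+ 2 * (2 * k) = 1 - e.
    by rewrite sqr_sqrtr ?divfK ?gt_eqF // divr_ge0 ?subr_ge0 // ltW.
  have s1 : s ^+ 2 * (2 * k) < 1 by rewrite s2; lra.
  have ss0 : s <= s0.
    rewrite -ler_sqr ?nnegrE ?sqrtr_ge0 // -(ler_pM2r k2).
    exact: le_trans (ltW s1) out_ball.
  have sk : s * k <= r by rewrite -[leRHS]s0k ler_pM2r.
  have := lorentz_bounded (Ha tt) (Hc _ (ray_poly s (sqrtr_ge0 _) sk s1)).
  rewrite gP lorentzC lorentz_basepointE normrN /ray s2 mxE col_mxEd mxE.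
  have -> : Num.sqrt (1 - (1 - e)) = (M + 1)^-1.
    by rewrite subKr sqrtr_sqr gtr0_norm // invr_gt0.
  rewrite invrK -/M eqxx [_ * 1%:R]mulr1 gtr0_norm // => h.
  by exfalso; lra.
pose v := g *m col_mx q1 r%:M; pose w := g *m col_mx q2 r%:M.
have Nv : N v by rewrite NE; exists q1.
have Nw : N w by rewrite NE; exists q2.
have vv : lorentz v v = 1 - r ^+ 2 by rewrite gP lorentz_col d1 expr2.
have ww : lorentz w w = 1 - r ^+ 2 by rewrite gP lorentz_col d2 expr2.
have vw : lorentz v w = phi / 2 - r ^+ 2 by rewrite gP lorentz_col d12 expr2.
have v_neq_w : v <> w by move=> e; move: vw; rewrite -e vv; lra.
have rr : r ^+ 2 < 1 by rewrite expr_lt1 // ltW.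
have s0_gt0 : 0 < s0 by rewrite divr_gt0.
have adj : adjacent_facets N v w.
  exists (g *m ray s0); split; first by apply: ray_poly => //; rewrite s0k.
  - by rewrite gP lray q1m s0k subrr mulr0.
  - by rewrite gP lray q2m s0k subrr mulr0.
  move=> z; rewrite NE => -[q Vq <-] zv zw.
  have n1 : q <> q1 by move=> e; apply: zv; rewrite e.
  have n2 : q <> q2 by move=> e; apply: zw; rewrite e.
  rewrite gP lray nmulr_llt0; last first.
    rewrite subr_lt0 -[ltRHS]s0k ltr_pM2l // /m dotDr.
    by apply: le_lt_trans (dle q Vq n1 n2) _; rewrite /k; lra.
  by rewrite invr_gt0 sqrtr_gt0 subr_gt0.
have := Nright v w Nv Nw v_neq_w adj; rewrite /dihedral_angle vv ww vw -expr2.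
rewrite sqr_sqrtr ?subr_ge0 ?ltW // => /(congr1 cos).
have r2k : 2 * r ^+ 2 < k.
  move: in_ball; rewrite /s0 (_ : _ * _ = 2 * r ^+ 2 / k); last by field; rewrite gt_eqF.
  by rewrite ltr_pdivrMr // mul1r.
have d0 : 0 < 1 - r ^+ 2 by rewrite subr_gt0.
rewrite acosK ?cos_pihalf; last first.
  rewrite in_itv /= -mulNr ler_pdivlMr // ler_pdivrMr //.
  by apply/andP; split; move: r2k; rewrite /k; lra.
move=> /eqP; rewrite oppr_eq0 mulf_eq0 invr_eq0 (gt_eqF d0) orbF subr_eq0.
by move=> /eqP.
Qed.

(** Two antipodal vertices of each colour, whose normals add up to a multiple of the
    base point. *)
Definition balanced_vertices : seq (seq golden_int) :=
  coset_reps ++ [seq [seq gi_opp z | z <- x] | x <- coset_reps].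

Lemma sum_balanced_vertices : \sum_(x <- balanced_vertices) @vertex R x = 0.
Proof.
have vN x : vertex [seq gi_opp z | z <- x] = - @vertex R x.
  apply/matrixP => i j; rewrite !mxE.
  have -> : gi_nth [seq gi_opp z | z <- x] i = gi_opp (gi_nth x i).
    rewrite /gi_nth; have [ix|ix] := ltnP i (size x); first by rewrite (nth_map (0, 0)).
    by rewrite !nth_default ?size_map.
  by rewrite gi_val_opp mulNr.
by rewrite big_cat big_map /= (eq_bigr _ (fun x _ => vN x)) sumrN subrr.
Qed.

Lemma sum_balanced_colours :
  \sum_(x <- balanced_vertices) @simplex R (colour x) = 0.
Proof.
rewrite -(big_map colour xpredT (@simplex R)).
have -> : [seq colour x | x <- balanced_vertices] = iota 0 5 ++ iota 0 5 by vm_compute.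
by rewrite big_cat /= sum_simplex addr0.
Qed.

Lemma balanced_facets : exists ws : seq S, map val ws = balanced_vertices.
Proof.
have ws_in : all (fun x => x \in cell600) balanced_vertices by vm_compute.
exists (pmap insub balanced_vertices); rewrite pmap_filter; last exact: insubK.
by apply/all_filterP; move: ws_in; apply: sub_all => x xc; rewrite insubT.
Qed.

Theorem cell120_proper_affine_action N : compact_right_angled_120cell N ->
  admits_proper_affine_action 8 (reflection_group N).
Proof.
move=> /right_angled_120cell_radius[g [r [[/indef_orthP gP _] r0 r2 ->]]].
have /andP[p1 p2] := @golden_bounds R.
have d0 : 0 < 1 - r ^+ 2 by rewrite r2; lra.
pose nu := Num.sqrt (1 - r ^+ 2).
have nu0 : 0 < nu by rewrite sqrtr_gt0.
have nuV : nu^-1 * nu^-1 = (1 - r ^+ 2)^-1 by rewrite -invfM -expr2 sqr_sqrtr // ltW.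
pose v (i : S) : 'cV[R]_(4 + 1) := nu^-1 *: (g *m col_mx (vtx i) r%:M).
have vE i : v i = nu^-1 *: (g *m col_mx (vertex (val i)) r%:M) by [].
have vv i j : lorentz (v i) (v j) = (1 - r ^+ 2)^-1 * (dot (vtx i) (vtx j) - r ^+ 2).
  by rewrite !lorentzE gP lorentz_col mulrA nuV expr2.
have vC : coxeter_normals com v.
  split=> [i|i j ij|i j ij nij]; rewrite vv.
  - by rewrite dot_vertex_diag ?(valP i) // mulVf // gt_eqF.
  - by rewrite dot_vertex_adjacent // r2 subrr mulr0.
  - rewrite mulrC ler_pdivrMr // r2.
    by have := @dot_vertex_far R _ _ (valP i) (valP j) ij nij; rewrite -/(vtx i) -/(vtx j); lra.
have [ws wsE] := balanced_facets.
have := @coloured_proper_affine_action R S com 4 4 com_sym com_irr vtx colr (phi / 2)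
  (1 / 4) (phi - 3 / 2) ws coloured_cell120 _ _ _ _ _ _ _ 4 v (g *m basepoint) _ vC.
apply.
- by [].
- by rewrite subr_gt0.
- by lra.
- by lra.
- by rewrite -(size_map val) wsE.
- by rewrite -(big_map val xpredT (@vertex R)) wsE sum_balanced_vertices.
- by rewrite -(big_map val xpredT (fun x => @simplex R (colour x))) wsE sum_balanced_colours.
- move=> i; rewrite vE lorentzZr gP pmulr_rlt0 ?invr_gt0 //.
  by rewrite lorentzC lorentz_basepointE col_mxEd mxE eqxx mulr1n oppr_lt0.
- move=> A; apply: generated_word (reflections_coxeter vC) _.
  move=> B [z [q Vq <-] <-]; have [x xc ->] := vertices_600cell_vertex Vq.
  exists (SeqSub xc); rewrite /reflections vE reflection_mx_scale //.
  by rewrite invr_eq0 gt_eqF.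
Qed.

End Cell120.

(** * Lorentzian geometry of points and frames *)

Section Timelike.
Context {R : realType} {n : nat}.
Implicit Types (x y z v w p : 'cV[R]_(n + 1)).

Lemma dot_ge0 (u : 'cV[R]_n) : 0 <= dot u u.
Proof. by rewrite dotE; apply: sumr_ge0 => i _; rewrite -expr2 sqr_ge0. Qed.

Lemma dot_eq0 (u : 'cV[R]_n) : dot u u = 0 -> u = 0.
Proof.
rewrite dotE => /eqP; rewrite psumr_eq0 => [/allP h|i _]; last by rewrite -expr2 sqr_ge0.
apply/matrixP => i j; rewrite ord1 mxE.
by have := h i (mem_index_enum _); rewrite mulf_eq0 orbb => /eqP.
Qed.

Lemma dot_cauchy (u t : 'cV[R]_n) : dot u t ^+ 2 <= dot u u * dot t t.
Proof.
have [t0|t0] := eqVneq (dot t t) 0.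
  by rewrite (dot_eq0 t0) !dot0r mulr0 expr0n.
have tp : 0 < dot t t by rewrite lt_neqAle eq_sym t0 dot_ge0.
have := dot_ge0 (dot t t *: u + (- dot u t) *: t).
rewrite !(dotDl, dotDr, dotZl, dotZr) (dotC t u).
rewrite (_ : _ + _ = dot t t * (dot u u * dot t t - dot u t ^+ 2)); last by ring.
by rewrite pmulr_rge0 // subr_ge0.
Qed.

Lemma lorentz_split x y :
  lorentz x y = dot (usubmx x) (usubmx y) - dsubmx x 0 0 * dsubmx y 0 0.
Proof. by rewrite -{1}[x]vsubmxK -{1}[y]vsubmxK lorentz_col_mx. Qed.

Lemma spacelike_orth p w : lorentz p p < 0 -> lorentz p w = 0 -> w != 0 ->
  0 < lorentz w w.
Proof.
rewrite !lorentz_split; set P := usubmx p; set W := usubmx w.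
set a := dsubmx p 0 0; set b := dsubmx w 0 0 => pp pw w0.
have cs := dot_cauchy P W; have W0 := dot_ge0 W; have P0 := dot_ge0 P.
rewrite ltNge; apply/negP => ww; move: w0; apply/negP; rewrite negbK.
have b0 : b = 0.
  apply/eqP; rewrite -sqrf_eq0 -[_ == 0]negbK; apply/negP => b2.
  have bp : 0 < b ^+ 2 by rewrite lt_neqAle eq_sym b2 sqr_ge0.
  have : (a * b) ^+ 2 <= dot P P * b ^+ 2.
    rewrite -[a * b](_ : dot P W = _); last by lra.
    by apply: le_trans cs _; rewrite ler_wpM2l //; move: ww; rewrite -expr2; lra.
  rewrite exprMn ler_pM2r //; move: pp; rewrite -expr2; lra.
have Wz : dot W W = 0 by move: ww W0; rewrite b0; lra.
rewrite -[w]vsubmxK -/W (dot_eq0 Wz); apply/eqP.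
have -> : dsubmx w = 0 by apply/matrixP => i j; rewrite !ord1 [RHS]mxE; exact: b0.
exact: col_mx0.
Qed.

(** The form is positive definite on the orthogonal complement of a timelike
    vector. *)
Lemma lorentz_cauchy p v w : lorentz p p < 0 -> lorentz p v = 0 -> lorentz p w = 0 ->
  lorentz v w ^+ 2 <= lorentz v v * lorentz w w.
Proof.
move=> pp pv pw; have [->|w0] := eqVneq w 0; first by rewrite !lorentz0r mulr0 expr0n.
have wp := spacelike_orth pp pw w0.
pose u := lorentz w w *: v - lorentz v w *: w.
have pu : lorentz p u = 0 by rewrite !lorentzE pv pw !mulr0 subr0.
have : 0 <= lorentz u u.
  by have [->|u0] := eqVneq u 0; [rewrite lorentz0r|apply/ltW/(spacelike_orth pp pu u0)].
rewrite !lorentzE (lorentzC w v).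
rewrite (_ : _ + _ = lorentz w w * (lorentz v v * lorentz w w - lorentz v w ^+ 2)); last by ring.
by rewrite pmulr_rge0 // subr_ge0.
Qed.

Lemma lorentz_hyperboloid_lt0 x y : hyperboloid x -> hyperboloid y -> lorentz x y < 0.
Proof.
move=> [xx x0] [yy y0]; move: xx yy; rewrite !lorentz_split.
set X := usubmx x; set Y := usubmx y; set a := dsubmx x 0 0; set b := dsubmx y 0 0.
move=> xx yy; have ab : 0 < a * b by apply: mulr_gt0.
have cs := dot_cauchy X Y; rewrite subr_lt0 ltNge; apply/negP => h.
have : (a * b) ^+ 2 <= dot X Y ^+ 2 by rewrite !expr2 ler_pM // ltW.
move=> /le_trans /(_ cs); rewrite exprMn.
have -> : dot X X = a ^+ 2 - 1 by move: xx; rewrite -expr2; lra.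
have -> : dot Y Y = b ^+ 2 - 1 by move: yy; rewrite -expr2; lra.
have a1 : 1 <= a ^+ 2 by move: xx (dot_ge0 X); rewrite -expr2; lra.
have b1 : 1 <= b ^+ 2 by move: yy (dot_ge0 Y); rewrite -expr2; lra.
by move: (a ^+ 2) (b ^+ 2) a1 b1 => A B *; lra.
Qed.

(** The Cauchy-Schwarz inequality puts the quotient in the domain of [acos]. *)
Lemma right_angle_orth x a b : lorentz x x < 0 -> lorentz x a = 0 -> lorentz x b = 0 ->
  a != 0 -> b != 0 ->
  acos (lorentz a b / (Num.sqrt (lorentz a a) * Num.sqrt (lorentz b b))) = pi / 2 ->
  lorentz a b = 0.
Proof.
move=> xx xa xb a0 b0 /(congr1 cos).
have aa := spacelike_orth xx xa a0; have bb := spacelike_orth xx xb b0.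
have cs := lorentz_cauchy xx xa xb.
have d0 : 0 < Num.sqrt (lorentz a a) * Num.sqrt (lorentz b b).
  by rewrite mulr_gt0 // sqrtr_gt0.
rewrite acosK ?cos_pihalf.
  by move=> /eqP; rewrite mulf_eq0 invr_eq0 (gt_eqF d0) orbF => /eqP.
rewrite in_itv /= -ler_norml normrM normfV (gtr0_norm d0) ler_pdivrMr // mul1r.
by rewrite -ler_sqr ?nnegrE ?(ltW d0) // real_normK ?num_real // exprMn !sqr_sqrtr ?(ltW aa) ?(ltW bb).
Qed.

Lemma direction_orth x y : hyperboloid x -> lorentz x (direction x y) = 0.
Proof. by move=> [xx _]; rewrite /direction !lorentzE xx; ring. Qed.

Lemma direction_neq0 x y : hyperboloid x -> hyperboloid y -> x != y -> direction x y != 0.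
Proof.
move=> Hx Hy; apply: contraNneq; rewrite /direction => /eqP.
rewrite addr_eq0 -scaleNr => /eqP yE; set c := - lorentz x y in yE.
have c0 : 0 < c by rewrite oppr_gt0 lorentz_hyperboloid_lt0.
have [xx _] := Hx; have [yy _] := Hy; move: yy; rewrite yE !lorentzE xx => yy.
have c1 : c = 1.
  apply/eqP; rewrite -(@eqrXn2 _ 2) //; last by rewrite ltW.
  by rewrite expr1n; apply/eqP; move: yy; rewrite expr2; lra.
by rewrite c1 scale1r.
Qed.

End Timelike.

Section Frames.
Context {R : realType}.
Implicit Types (x : 'cV[R]_(2 + 1)).

Lemma dual_frame_expansion x e1 e2 e3 f1 f2 f3 :
  [/\ lorentz e1 f2 = 0, lorentz e1 f3 = 0 & lorentz e1 f1 != 0] ->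
  [/\ lorentz e2 f1 = 0, lorentz e2 f3 = 0 & lorentz e2 f2 != 0] ->
  [/\ lorentz e3 f1 = 0, lorentz e3 f2 = 0 & lorentz e3 f3 != 0] ->
  x = (lorentz x f1 / lorentz e1 f1) *: e1 + (lorentz x f2 / lorentz e2 f2) *: e2
    + (lorentz x f3 / lorentz e3 f3) *: e3.
Proof.
move=> [a12 a13 a11] [a21 a23 a22] [a31 a32 a33].
pose E : 'M[R]_(2 + 1) := \matrix_(i, j) (nth 0 [:: e1; e2; e3] j) i 0.
pose F : 'M[R]_(2 + 1) := \matrix_(i, j)
  (nth 0 [:: (lorentz e1 f1)^-1 *: f1; (lorentz e2 f2)^-1 *: f2;
             (lorentz e3 f3)^-1 *: f3] i) j 0.
have FE (y : 'cV[R]_(2 + 1)) i : (F *m lorentz_mx *m y) i 0 =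
    lorentz (nth 0 [:: (lorentz e1 f1)^-1 *: f1; (lorentz e2 f2)^-1 *: f2;
             (lorentz e3 f3)^-1 *: f3] i) y.
  rewrite /lorentz; have -> : (nth 0 [:: (lorentz e1 f1)^-1 *: f1; (lorentz e2 f2)^-1 *: f2;
             (lorentz e3 f3)^-1 *: f3] i)^T = row i F.
    by apply/matrixP => a b; rewrite !mxE ord1.
  by rewrite -!row_mul !mxE.
have FJE : F *m lorentz_mx *m E = 1%:M.
  apply/matrixP => i j.
  have -> : (F *m lorentz_mx *m E) i j = (F *m lorentz_mx *m (nth 0 [:: e1; e2; e3] j)) i 0.
    by rewrite [LHS]mxE [RHS]mxE; apply: eq_bigr => k _; rewrite [E _ _]mxE.
  rewrite FE mxE.
  by case: i => -[|[|[|//]]] hi; case: j => -[|[|[|//]]] hj /=;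
    rewrite lorentzZl ?(lorentzC f1) ?(lorentzC f2) ?(lorentzC f3)
      ?a12 ?a13 ?a21 ?a23 ?a31 ?a32 ?mulr0 ?mulVf.
have := mulmx1C FJE => EFJ.
rewrite -[LHS]mul1mx -EFJ -mulmxA.
apply/matrixP => i j; rewrite ord1 [LHS]mxE.
rewrite !big_ord_recl big_ord0 addr0 !FE ![E _ _]mxE /= !lorentzZl ![in RHS]mxE.
by rewrite !(lorentzC x); ring.
Qed.

End Frames.

(** * Right-angled polygons *)

Lemma ordS_val k (i : 'I_k) :
  nat_of_ord (ordS i) = if nat_of_ord i == k.-1 then 0%N else i.+1.
Proof.
case: k i => [[]//|n] i; have := ltn_ord i; rewrite ltnS /= => ni.
have [->|ne] := eqVneq (nat_of_ord i) n; first by rewrite modnn.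
by rewrite modn_small // ltnS ltn_neqAle ne.
Qed.

Section PolygonGeometry.
Context {R : realType} {k : nat}.
Variables (p : 'I_k -> 'cV[R]_(2 + 1)) (v : 'I_k -> 'cV[R]_(2 + 1)).
Implicit Types i j m : 'I_k.
Local Notation S := (@ordS k).
Local Notation P := (@ord_pred k).

Hypothesis k_ge5 : (5 <= k)%N.
Hypothesis p_hyp : forall i, hyperboloid (p i).
Hypothesis p_inj : injective p.
Hypothesis v_unit : forall i, lorentz (v i) (v i) = 1.
Hypothesis v_p : forall i, lorentz (v i) (p i) = 0.
Hypothesis v_pS : forall i, lorentz (v i) (p (S i)) = 0.
Hypothesis v_neg : forall i j, j != i -> j != S i -> lorentz (v i) (p j) < 0.
Hypothesis right_angles : forall i, vertex_angle (p i) (p (P i)) (p (S i)) = pi / 2.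

Definition consecutive i j : bool := (j == S i) || (i == S j).

Lemma consecutive_sym : symmetric consecutive.
Proof. by move=> i j; rewrite /consecutive orbC. Qed.

Lemma ordS_neq i : S i != i.
Proof. by apply/eqP => /(congr1 (@nat_of_ord k)); rewrite ordS_val; case: eqP; lia. Qed.

Lemma ordSS_neq i : S (S i) != i.
Proof.
apply/eqP => /(congr1 (@nat_of_ord k)); rewrite !ordS_val.
by case: (nat_of_ord i =P k.-1); case: eqP; lia.
Qed.

Lemma consecutive_irr : irreflexive consecutive.
Proof. by move=> i; rewrite /consecutive (eq_sym i) (negbTE (ordS_neq i)). Qed.

Lemma p_lt0 i j : lorentz (p i) (p j) < 0.
Proof. exact: lorentz_hyperboloid_lt0. Qed.

Lemma v_p_le0 i j : lorentz (v i) (p j) <= 0.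
Proof.
have [->|ji] := eqVneq j i; first by rewrite v_p.
have [->|jSi] := eqVneq j (S i); first by rewrite v_pS.
by rewrite ltW // v_neg.
Qed.

Lemma p_unit i : lorentz (p i) (p i) = -1.
Proof. by have [] := p_hyp i. Qed.

Lemma p_timelike i : lorentz (p i) (p i) < 0.
Proof. by rewrite p_unit ltrN10. Qed.

(** In the tangent plane at the common vertex, each of the two normals is
    orthogonal to one side and hence parallel to the other one. *)
Lemma v_consecutive i : lorentz (v i) (v (S i)) = 0.
Proof.
pose x := p (S i); pose a := direction x (p i); pose b := direction x (p (S (S i))).
have Hx : hyperboloid x by apply: p_hyp.
have xa : lorentz x a = 0 by apply: direction_orth.
have xb : lorentz x b = 0 by apply: direction_orth.
have a0 : a != 0.
  by apply: direction_neq0 => //; rewrite (inj_eq p_inj) ordS_neq.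
have b0 : b != 0.
  by apply: direction_neq0 => //; rewrite (inj_eq p_inj) eq_sym ordS_neq.
have ab : lorentz a b = 0.
  apply: right_angle_orth xa xb a0 b0 _; first exact: p_timelike.
  by have := right_angles (S i); rewrite ordSK.
have aa := spacelike_orth (p_timelike _) xa a0.
have bb := spacelike_orth (p_timelike _) xb b0.
have va : lorentz (v i) a = 0 by rewrite /a /direction !lorentzE v_p v_pS mulr0 addr0.
have wb : lorentz (v (S i)) b = 0.
  by rewrite /b /direction !lorentzE v_pS v_p mulr0 addr0.
rewrite [v i](@dual_frame_expansion R _ x a b x a b).
- rewrite va v_pS !mul0r !scale0r !add0r lorentzZl (lorentzC b) wb mulr0 //.
- by split=> //; rewrite lt_eqF // p_timelike.
- by split; rewrite // 1?lorentzC // gt_eqF.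
- by split; rewrite // 1?lorentzC // gt_eqF.
Qed.

Lemma vertex_frame x m : x = lorentz x (v m) *: v m + lorentz x (v (S m)) *: v (S m)
  - lorentz x (p (S m)) *: p (S m).
Proof.
rewrite {1}(@dual_frame_expansion R x (v m) (v (S m)) (p (S m)) (v m) (v (S m)) (p (S m))).
- by rewrite !v_unit p_unit !divr1 invrN1 mulrN1 scaleNr.
- by split; rewrite ?v_consecutive ?v_pS ?v_unit ?oner_neq0.
- by split; rewrite 1?lorentzC ?v_consecutive ?v_p ?v_unit ?oner_neq0 // lorentzC v_p.
- by split; rewrite 1?lorentzC ?v_pS ?v_p // p_unit oppr_eq0 oner_neq0.
Qed.

Lemma p_vS m : lorentz (p m) (v (S m)) < 0.
Proof. by rewrite lorentzC v_neg // eq_sym ?ordS_neq // ordSS_neq. Qed.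

Lemma pS_vP m : lorentz (p (S m)) (v (P m)) < 0.
Proof.
rewrite lorentzC v_neg // ?ord_predK ?ordS_neq //.
by rewrite -{1}(ord_predK m) ordSS_neq.
Qed.

Lemma v_pred m : lorentz (v m) (v (P m)) = 0.
Proof. by rewrite lorentzC -{2}(ord_predK m) v_consecutive. Qed.

Lemma v_pred_p m : lorentz (v (P m)) (p m) = 0.
Proof. by rewrite -{2}(ord_predK m) v_pS. Qed.

Lemma side_frame x m : x = lorentz x (v m) *: v m
  + (lorentz x (v (S m)) / lorentz (p m) (v (S m))) *: p m
  + (lorentz x (v (P m)) / lorentz (p (S m)) (v (P m))) *: p (S m).
Proof.
rewrite {1}(@dual_frame_expansion R x (v m) (p m) (p (S m)) (v m) (v (S m)) (v (P m))).
- by rewrite v_unit divr1.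
- by split; rewrite ?v_consecutive ?v_pred ?v_unit ?oner_neq0.
- by split; [rewrite lorentzC v_p|rewrite lorentzC v_pred_p|rewrite lt_eqF // p_vS].
- by split; [rewrite lorentzC v_pS|rewrite lorentzC v_p|rewrite lt_eqF // pS_vP].
Qed.

(** The vertex [p (S m)] sees the side [i] in a direction between the two sides at
    this vertex.  In this direction the distance to the line of the side [i]
    decreases, so it decreases along one of the two sides. *)
Lemma vertex_visible i m : S m != i -> S m != S i ->
  0 <= lorentz (v i) (v m) -> lorentz (v i) (v (S m)) < 0.
Proof.
move=> mi mSi gm; rewrite ltNge; apply/negP => gSm.
have := congr1 (lorentz (v i)) (vertex_frame (p i) m); rewrite v_p !lorentzE.
rewrite !(lorentzC (p i) (v _)) => e.
have h1 : lorentz (v m) (p i) * lorentz (v i) (v m) <= 0 by rewrite mulr_le0_ge0 // v_p_le0.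
have h2 : lorentz (v (S m)) (p i) * lorentz (v i) (v (S m)) <= 0.
  by rewrite mulr_le0_ge0 // v_p_le0.
have h3 : 0 < lorentz (p i) (p (S m)) * lorentz (v i) (p (S m)).
  by rewrite nmulr_rgt0 ?p_lt0 // v_neg.
by move: e h1 h2 h3; lra.
Qed.

(** The last two inequalities say that the distance to the line of the side [i] has
    a minimum inside the side [m], and the first one that it does not decrease from
    there towards the inside of the polygon.  By convexity this positive number would
    be its minimum on the whole polygon, which contains the side [i]. *)
Lemma side_visible i m : 0 <= lorentz (v i) (v m) -> lorentz (v i) (v (S m)) < 0 ->
  lorentz (v i) (v (P m)) < 0 -> False.
Proof.
move=> gm gS gP; have := congr1 (lorentz (p i)) (side_frame (v i) m).
rewrite !lorentzE lorentzC v_p => e.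
have h1 : lorentz (v i) (v m) * lorentz (p i) (v m) <= 0.
  by rewrite mulr_ge0_le0 // lorentzC v_p_le0.
have h2 : lorentz (v i) (v (S m)) / lorentz (p m) (v (S m)) * lorentz (p i) (p m) < 0.
  by rewrite pmulr_rlt0 ?p_lt0 // nmulr_rgt0 // invr_lt0 p_vS.
have h3 : lorentz (v i) (v (P m)) / lorentz (p (S m)) (v (P m)) * lorentz (p i) (p (S m)) < 0.
  by rewrite pmulr_rlt0 ?p_lt0 // nmulr_rgt0 // invr_lt0 pS_vP.
by move: e h1 h2 h3; lra.
Qed.

Lemma far_normals_lt0 i m : m != i -> ~~ consecutive i m -> lorentz (v i) (v m) < 0.
Proof.
rewrite /consecutive negb_or => mi /andP[mSi iSm].
rewrite ltNge; apply/negP => gm.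
have gS : lorentz (v i) (v (S m)) < 0.
  by apply: vertex_visible => //; [rewrite eq_sym|rewrite (inj_eq (@ordS_inj k))].
have gP : lorentz (v i) (v (P m)) < 0.
  rewrite ltNge; apply/negP => gP.
  have : lorentz (v i) (v (S (P m))) < 0 by apply: vertex_visible => //; rewrite ord_predK.
  by rewrite ord_predK ltNge gm.
exact: side_visible gm gS gP.
Qed.

(** In the frame of the side [i], the vector [v j] is a multiple of [v i] plus a
    nonnegative combination of two vertices.  The latter is not spacelike, so the
    coefficient of [v i] is at least 1 in absolute value. *)
Lemma far_normals i j : i != j -> ~~ consecutive i j -> lorentz (v i) (v j) <= -1.
Proof.
move=> ij nij; have g0 : lorentz (v i) (v j) < 0 by rewrite far_normals_lt0 // eq_sym.
have [nSi nSj] : j != S i /\ i != S j by move: nij; rewrite /consecutive negb_or => /andP.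
have le0 m : m != j -> lorentz (v j) (v m) <= 0.
  move=> mj; have [|njm] := boolP (consecutive j m); last by rewrite ltW // far_normals_lt0.
  case/orP => /eqP ->; first by rewrite v_consecutive.
  by rewrite lorentzC v_consecutive.
have := side_frame (v j) i; set l := _ / _; set u := _ / _ => vj.
have l0 : 0 <= l.
  by rewrite mulr_le0 ?invr_le0 ?(ltW (p_vS i)) // le0 // eq_sym.
have u0 : 0 <= u.
  rewrite mulr_le0 ?invr_le0 ?(ltW (pS_vP i)) // le0 //.
  by apply: contraNneq nSj => <-; rewrite ord_predK.
have := v_unit j; rewrite {1 2}vj !lorentzE v_unit !p_unit v_p v_pS.
rewrite !(lorentzC _ (v i)) v_p v_pS (lorentzC (p (S i))) => e.
have uu : 0 <= u * u by apply: mulr_ge0.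
have ll : 0 <= l * l by apply: mulr_ge0.
have lu : l * u * lorentz (p i) (p (S i)) <= 0.
  by apply: mulr_ge0_le0; [apply: mulr_ge0|apply/ltW/p_lt0].
have g2 : 1 <= lorentz (v i) (v j) ^+ 2.
  by move: e uu ll lu; rewrite expr2; lra.
rewrite leNgt; apply/negP => g1.
have : lorentz (v i) (v j) ^+ 2 < 1 by rewrite -sqrrN expr_lt1 ?oppr_ge0 ?ltW // ltrNl.
by rewrite ltNge g2.
Qed.

Lemma polygon_coxeter_normals : coxeter_normals consecutive v.
Proof.
split=> [//|i j|]; last exact: far_normals.
by case/orP => /eqP ->; [|rewrite lorentzC]; apply: v_consecutive.
Qed.

Lemma vertex_sum_interior i : lorentz (\sum_j p j) (v i) < 0.
Proof.
rewrite lorentzC lorentz_sumr (bigD1 (S (S i))) //=.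
have h : lorentz (v i) (p (S (S i))) < 0 by rewrite v_neg // ?ordSS_neq ?ordS_neq.
rewrite ltr_wnDr // sumr_le0 // => j _; exact: v_p_le0.
Qed.

Lemma side_normal_reflection i w : side_normal p i w ->
  reflection_mx w = reflection_mx (v i).
Proof.
move=> [w0 wp wpS].
have wE : w = lorentz w (v i) *: v i.
  rewrite {1}(@dual_frame_expansion R w (v i) (v (S i)) (v (P i)) (v i) (p i) (p (S i))).
  - by rewrite wp wpS !mul0r !scale0r !addr0 v_unit divr1.
  - by split; rewrite ?v_p ?v_pS ?v_unit ?oner_neq0.
  - split; [by rewrite lorentzC v_consecutive|by rewrite v_p|].
    by rewrite lorentzC lt_eqF // p_vS.
  - split; [by rewrite lorentzC v_pred|by rewrite v_pred_p|].
    by rewrite lorentzC lt_eqF // pS_vP.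
rewrite wE reflection_mx_scale //; apply/eqP => c0.
by move: w0; rewrite wE c0 scale0r lorentz0r ltxx.
Qed.

End PolygonGeometry.

(** * Deformations of regular polygons *)

Section RegularPolygon.
Context {R : realType} {k : nat}.
Hypothesis k_ge6 : (6 <= k)%N.
Hypothesis k_even : ~~ odd k.
Implicit Types i j : 'I_k.

Let theta : R := pi *+ 2 / k%:R.
Let c0 := cos theta.
Let k_gt0 : 0 < k%:R :> R. Proof. by rewrite ltr0n; lia. Qed.

Definition polygon_vertex i : 'cV[R]_2 :=
  \col_l (if l == ord0 then cos (i%:R * theta) else sin (i%:R * theta)).
Definition polygon_colour i : 'cV[R]_1 := const_mx ((-1) ^+ i).

Lemma dot_polygon_vertex i j :
  dot (polygon_vertex i) (polygon_vertex j) = cos (i%:R * theta - j%:R * theta).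
Proof. by rewrite dotE !big_ord_recl big_ord0 !mxE /= addr0 cosB. Qed.

Lemma dot_polygon_colour i j :
  dot (polygon_colour i) (polygon_colour j) = (-1) ^+ (i + j).
Proof. by rewrite dotE big_ord1 !mxE exprD. Qed.

Lemma cos_complement a : (a <= k)%N -> cos ((k - a)%:R * theta) = cos (a%:R * theta).
Proof.
move=> ak; rewrite natrB // mulrBl /theta mulrCA divff ?gt_eqF // mulr1.
by rewrite addrC cosD2pi cosN.
Qed.

Lemma theta_gt0 : 0 < theta.
Proof. by rewrite divr_gt0 // mulrn_wgt0 // pi_gt0. Qed.

Lemma cos_far a : (2 <= a)%N -> (a.*2 <= k)%N -> cos (a%:R * theta) <= cos (2 * theta).
Proof.
move=> a2 ak; have t0 := theta_gt0.
have api : a%:R * theta <= pi.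
  rewrite /theta mulrA ler_pdivrMr // -(mulr_natr pi 2) mulrCA ler_pM2l ?pi_gt0 //.
  by rewrite -natrM ler_nat muln2.
have aa : 2 * theta <= a%:R * theta by rewrite ler_pM2r // ler_nat.
have [->//|ne] := eqVneq (a%:R * theta) (2 * theta).
have h1 : a%:R * theta \in `[0, pi] by rewrite in_itv /= api mulr_ge0 // ltW.
have h2 : 2 * theta \in `[0, pi].
  by rewrite in_itv /= (le_trans aa api) andbT mulr_ge0 // ltW.
by rewrite ltW // ltr_cos // lt_neqAle eq_sym ne.
Qed.

Lemma c0_bounds : 0 < c0 < 1.
Proof.
have t0 := theta_gt0.
have th : theta < pi / 2.
  rewrite ltr_pdivrMr // mulrAC ltr_pdivlMr // -(mulr_natr pi 2) -mulrA ltr_pM2l ?pi_gt0 //.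
  by rewrite -natrM ltr_nat; lia.
rewrite cos_gt0_pihalf; last by rewrite th andbT (lt_trans _ t0) // oppr_lt0 divr_gt0 ?pi_gt0.
have tpi : theta <= pi.
  by apply: le_trans (ltW th) _; rewrite ler_pdivrMr // ler_peMr ?pi_ge0 // ler1n.
have h1 : theta \in `[0, pi] by rewrite in_itv /= tpi ltW.
have h2 : 0 \in `[0, (pi : R)] by rewrite in_itv /= lexx pi_ge0.
by rewrite -[ltRHS]cos0 /c0 ltr_cos.
Qed.

(** The far pairs of directions make an angle at least [2 * theta], and
    [cos (2 * theta) = 2 c0^2 - 1]. *)
Lemma coloured_regular_polygon : coloured_polytope consecutive
  polygon_vertex polygon_colour c0 1 (c0 * (1 - c0)).
Proof.
have dotS i : cos (i%:R * theta - (ordS i)%:R * theta) = c0 /\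
    (-1) ^+ (i + ordS i) = -1 :> R.
  have := ltn_ord i; rewrite ordS_val; case: eqP => [-> _|ik ik'].
    rewrite mul0r subr0 addn0 -subn1 cos_complement ?mul1r; last lia.
    by rewrite -signr_odd oddB ?(negbTE k_even) /= ?expr1 //; lia.
  rewrite -natr1 mulrDl mul1r opprD addrA subrr add0r cosN; split=> //.
  by rewrite addnS exprS addnn -mul2n exprM sqrrN !expr1n mulr1.
have /andP[c_gt0 c_lt1] := c0_bounds.
split; split.
- by move=> i; rewrite dot_polygon_vertex subrr cos0.
- move=> i j; rewrite dot_polygon_vertex /consecutive.
  by case/orP => /eqP ->; [|rewrite -cosN opprB]; case: (dotS i); case: (dotS j).
- move=> i j ij nij; rewrite dot_polygon_vertex.
  wlog ji : i j ij nij / (j < i)%N.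
    move=> W; have [/W|/W|/val_inj e] := ltngtP i j; last by rewrite e eqxx in ij.
      rewrite -cosN opprB; apply; first by rewrite eq_sym.
      by rewrite consecutive_sym.
    by apply.
  rewrite -mulrBl -natrB ?(ltnW ji) //; set a := (i - j)%N.
  have [a2 ak2] : (2 <= a)%N /\ (a <= k - 2)%N.
    move: nij; rewrite /consecutive negb_or => /andP[/eqP n1 /eqP n2].
    have {}n1 : nat_of_ord j <> ordS i by move/val_inj.
    have {}n2 : nat_of_ord i <> ordS j by move/val_inj.
    have := ltn_ord i; have := ltn_ord j; rewrite !ordS_val in n1 n2; rewrite /a.
    by move: n1 n2; case: eqP; case: eqP; lia.
  have c2 : cos (2 * theta) <= 2 * c0 - 1 - c0 * (1 - c0).
    rewrite mulr_natl cos_mulr2n -/c0 -mulr_natl.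
    have : 0 <= (1 - c0) ^+ 2 by apply: sqr_ge0.
    by rewrite expr2; nra.
  apply: le_trans c2; have [ak|ak] := leqP a.*2 k; first exact: cos_far.
  rewrite -(@cos_complement a); last by lia.
  by apply: cos_far; lia.
- by move=> i; rewrite dot_polygon_colour addnn -mul2n exprM sqrrN !expr1n.
- move=> i j; rewrite dot_polygon_colour.
  by case/orP => /eqP ->; [|rewrite addnC]; case: (dotS i); case: (dotS j).
- by move=> i j; rewrite dot_polygon_colour -signr_odd; case: odd; [right|left].
Qed.

Let half : nat := k./2.
Let half2 : k = (half + half)%N.
Proof. by rewrite /half; have := odd_double_half k; rewrite (negbTE k_even) -addnn. Qed.

Let lt0k : (0 < k)%N. Proof. lia. Qed.
Let lt1k : (1 < k)%N. Proof. lia. Qed.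
Let lthk : (half < k)%N. Proof. lia. Qed.
Let lth1k : (half.+1 < k)%N. Proof. lia. Qed.

(** Two opposite sides and their successors: the directions cancel, and so do the two
    colours whatever the parity of half the number of sides. *)
Definition balanced_sides : seq 'I_k :=
  [:: Ordinal lt0k; Ordinal lthk; Ordinal lt1k; Ordinal lth1k].

Lemma sum_balanced_sides : \sum_(i <- balanced_sides) polygon_vertex i = 0.
Proof.
have opp (i j : 'I_k) : j = (i + half)%N :> nat -> polygon_vertex i + polygon_vertex j = 0.
  move=> ij; have e : j%:R * theta = i%:R * theta + pi.
    rewrite ij natrD mulrDl; congr (_ + _).
    rewrite /theta mulrA -(mulr_natr pi 2) {1}half2 addnn -muln2 natrM.
    by field; rewrite pnatr_eq0; lia.
  apply/matrixP => l c; rewrite !mxE e cosDpi sinDpi.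
  by case: ifP; rewrite subrr.
have o0 := opp (Ordinal lt0k) (Ordinal lthk) (erefl _).
have o1 := opp (Ordinal lt1k) (Ordinal lth1k) (erefl _).
by rewrite !big_cons big_nil addr0 addrA o0 add0r.
Qed.

Lemma sum_balanced_side_colours : \sum_(i <- balanced_sides) polygon_colour i = 0.
Proof.
apply/matrixP => a b; rewrite !big_cons big_nil !mxE /= expr0 expr1 exprS; ring.
Qed.

Theorem polygon_proper_affine_action (p : 'I_k -> 'cV[R]_(2 + 1)) :
  right_angled_polygon p ->
  admits_proper_affine_action 3 (reflection_group (side_normals p)).
Proof.
move=> [[p_hyp p_inj sides] right].
have /choice[v0 Hv0] i : exists v, side_normal p i v /\
    forall j, j != i -> j != ordS i -> lorentz v (p j) < 0.
  by have [v nv lv] := sides i; exists v.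
pose v i := (Num.sqrt (lorentz (v0 i) (v0 i)))^-1 *: v0 i.
have s0 i : 0 < Num.sqrt (lorentz (v0 i) (v0 i)).
  by rewrite sqrtr_gt0; case: (Hv0 i) => -[].
have v_unit i : lorentz (v i) (v i) = 1.
  rewrite !lorentzE mulrA -invfM -expr2 sqr_sqrtr ?mulVf //.
    by rewrite gt_eqF //; case: (Hv0 i) => -[].
  by rewrite ltW //; case: (Hv0 i) => -[].
have v_p i : lorentz (v i) (p i) = 0.
  by rewrite lorentzZl; case: (Hv0 i) => -[_ -> _] _; rewrite mulr0.
have v_pS i : lorentz (v i) (p (ordS i)) = 0.
  by rewrite lorentzZl; case: (Hv0 i) => -[_ _ ->] _; rewrite mulr0.
have v_neg i j : j != i -> j != ordS i -> lorentz (v i) (p j) < 0.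
  by move=> ji jSi; rewrite lorentzZl pmulr_rlt0 ?invr_gt0 //; case: (Hv0 i) => _; apply.
have k5 : (5 <= k)%N by lia.
have vC := polygon_coxeter_normals k5 p_hyp p_inj v_unit v_p v_pS v_neg right.
have /andP[c_gt0 c_lt1] := c0_bounds.
have := @coloured_proper_affine_action R _ consecutive 2 1 (@consecutive_sym k)
  (consecutive_irr k5) polygon_vertex polygon_colour c0 1 (c0 * (1 - c0)) balanced_sides
  coloured_regular_polygon ltr01 _ _ c_lt1 isT sum_balanced_sides
  sum_balanced_side_colours 2 v (\sum_j p j) _ vC.
apply.
- by rewrite mulr_gt0 // subr_gt0.
- by rewrite ler_piMr ?(ltW c_gt0) // gerBl ltW.
- by move=> i; apply: (vertex_sum_interior k5 v_p v_pS v_neg).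
- move=> A; apply: generated_word (reflections_coxeter vC) _.
  move=> B [w [i sw] <-]; exists i.
  exact: (side_normal_reflection k5 p_hyp p_inj v_unit v_p v_pS v_neg right).
Qed.

End RegularPolygon.

(** * Proper affine actions *)

Theorem proposition1p6 (R : realType) :
  (forall (k : nat) (p : 'I_k -> 'cV[R]_(2 + 1)),
     (6 <= k)%N -> ~~ odd k -> right_angled_polygon p ->
     admits_proper_affine_action 3 (reflection_group (side_normals p)))
  /\
  (forall N : set 'cV[R]_(4 + 1),
     compact_right_angled_120cell N ->
     admits_proper_affine_action 8 (reflection_group N)).
Proof.
split=> [k p k6 k_even|N]; last exact: cell120_proper_affine_action.
exact: polygon_proper_affine_action.
Qed.
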